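(* Let $\lambda=(\lambda^0,\dots,\lambda^d)\in\mathbb{R}^{d+1}$ have positive entries, let $W$ be a two-sided $d$-dimensional Brownian motion with respect to $(\mathcal{F}_t)_{t\in\mathbb{R}}$ and let $\widehat{\mathbb{W}}^\lambda=(\widehat{\mathbb{W}}^\lambda_t)_{t\in\mathbb{R}}$ be the EFM-signature of $\widehat W_t=(t,W_t^1,\dots,W_t^d)$. Then $\widehat{\mathbb{W}}^\lambda$ is a Markov process in the sense that, for any measurable bounded function $f:L^1(T((\mathbb{R}^{d+1})))\to\mathbb{R}$, $$\mathbb{E}\big[f(\widehat{\mathbb{W}}^\lambda_t)\,\big|\,\mathcal{F}_s\big]=\mathbb{E}\big[f(\widehat{\mathbb{W}}^\lambda_t)\,\big|\,\widehat{\mathbb{W}}^\lambda_s\big],\qquad t\ge s.$$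
   Context: $T((\mathbb{R}^{d+1}))=\{(\ell^n)_{n\ge0}:\ell^n\in(\mathbb{R}^{d+1})^{\otimes n}\}$, with elements $\ell=\sum_v\ell^vv$ indexed by words $v$ in the letters $\{0,1,\dots,d\}$. $\|\ell\|_1=\sum_v|\ell^v|$ and $L^1(T((\mathbb{R}^{d+1})))=\{\ell:\|\ell\|_1<\infty\}$ is a Banach space equipped with its Borel $\sigma$-algebra. The EFM-signature takes values in this space almost surely. Two-sided Brownian motion: a centered continuous Gaussian process $W=(W_t)_{t\in\mathbb{R}}$ with $W_0=0$, independent components, such that for all $s\in\mathbb{R}$, $t>0$ each component of $W_{s+t}-W_s$ is $\mathcal{N}(0,t)$ and $W_{s+t}-W_s$ is independent of $\mathcal{F}_s$ (increments up to time $t$ being $\mathcal F_t$-measurable). For a word, $\lambda^{i_1\cdots i_n}=\sum_k\lambda^{i_k}$. With $\widehat W^0_t=t$ and $\widehat W^i=W^i$, the EFM-signature has components $\widehat{\mathbb{W}}^{\lambda,\varnothing}_t=1$ and $\widehat{\mathbb{W}}^{\lambda,i_1\cdots i_n}_t=\int_{-\infty}^te^{-\lambda^{i_1\cdots i_n}(t-u)}\,\widehat{\mathbb{W}}^{\lambda,i_1\cdots i_{n-1}}_u\circ d\widehat W^{i_n}_u$ (improper Stratonovich integrals). *)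

(* Defs.v *)
From HB Require Import structures.
From mathcomp Require Import all_boot all_order all_algebra.
From mathcomp Require Import all_classical all_reals all_analysis.
From mathcomp Require Import measurable_realfun.

Set Implicit Arguments.
Unset Strict Implicit.
Unset Printing Implicit Defensive.

Import Order.TTheory GRing.Theory Num.Theory.
Import numFieldNormedType.Exports.

Local Open Scope classical_set_scope.
Local Open Scope ring_scope.

Notation word d := (seq 'I_d.+1).

(* An element of T((R^(d+1))) is encoded by its coordinates on the words; the
   letter 0 stands for time. *)
Definition tensor_series (R : realType) (d : nat) : Type := word d -> R^o.

HB.instance Definition _ (R : realType) d :=
  GRing.Lmodule.copy (tensor_series R d) (word d -> R^o).

Section l1_norm.
Context {R : realType} {d : nat}.
Implicit Types x y : tensor_series R d.

Definition enorm1 x : \bar R := \esum_(w in [set: word d]) `|x w|%:E.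

Definition in_L1 : {pred tensor_series R d} := fun x => (enorm1 x < +oo)%E.

Lemma enorm1_ge0 x : (0 <= enorm1 x)%E.
Proof. by apply: esum_ge0 => w _; rewrite lee_fin. Qed.

Lemma le_enorm1D x y : (enorm1 (x + y)%R <= enorm1 x + enorm1 y)%E.
Proof.
rewrite /enorm1 -esumD => [|w _|w _]; rewrite ?lee_fin//.
by apply: le_esum => w _; rewrite -EFinD lee_fin ler_normD.
Qed.

Lemma enorm1Z_le (a : R) x : (enorm1 (a *: x)%R <= `|a|%:E * enorm1 x)%E.
Proof.
apply: ub_ereal_sup => _ [X fX <-].
rewrite (eq_fsbigr (fun w => `|a|%:E * `|x w|%:E)%E); last first.
  by move=> w _; rewrite -EFinM -normrM.
rewrite -ge0_mule_fsumr; last by move=> w; rewrite lee_fin.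
by rewrite lee_wpmul2l ?lee_fin//; apply: ereal_sup_ubound; exists X.
Qed.

Lemma enorm10 : enorm1 0 = 0%E.
Proof. by rewrite /enorm1 esum1// => w _; rewrite normr0. Qed.

Fact in_L1_submod_closed : submod_closed in_L1.
Proof.
split=> [|a x y]; rewrite /in_L1 !unfold_in ?enorm10// => xfin yfin.
apply: le_lt_trans (le_enorm1D _ _) _; rewrite lte_add_pinfty//.
apply: le_lt_trans (enorm1Z_le _ _) _.
by rewrite lte_mul_pinfty ?lee_fin.
Qed.

HB.instance Definition _ :=
  GRing.isSubmodClosed.Build R _ in_L1 in_L1_submod_closed.

Record L1 := MkL1 { L1val :> tensor_series R d; L1valP : in_L1 L1val }.

HB.instance Definition _ := [isSub for L1val].
HB.instance Definition _ := [Choice of L1 by <:].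
HB.instance Definition _ := [SubChoice_isSubLmodule of L1 by <:].

Definition norm1 (x : L1) : R := fine (enorm1 x).

Lemma norm1E (x : L1) : (norm1 x)%:E = enorm1 x.
Proof. by rewrite /norm1 fineK// ge0_fin_numE ?enorm1_ge0//; exact: L1valP. Qed.

Lemma ler_norm1D (x y : L1) : norm1 (x + y) <= norm1 x + norm1 y.
Proof. by rewrite -lee_fin EFinD !norm1E le_enorm1D. Qed.

Lemma norm1Z (a : R) (x : L1) : norm1 (a *: x) = `|a| * norm1 x.
Proof.
have le_normZ (b : R) (y : L1) : norm1 (b *: y) <= `|b| * norm1 y.
  by rewrite -lee_fin EFinM !norm1E enorm1Z_le.
have [->|a0] := eqVneq a 0.
  by rewrite scale0r normr0 mul0r /norm1 enorm10.
apply/eqP; rewrite eq_le le_normZ/= -ler_pdivlMl ?normr_gt0//.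
by rewrite -normfV -{1}[x](scalerK a0) le_normZ.
Qed.

Lemma norm1_eq0 (x : L1) : norm1 x = 0 -> x = 0.
Proof.
move=> x0; apply/val_inj/funext => w; apply/eqP => /=.
rewrite -normr_eq0 eq_le normr_ge0 andbT -lee_fin -[leRHS]/(0%:E) -x0 norm1E.
apply: esum_ge; exists [set w]; first by split; [exact: finite_set1|].
by rewrite fsbig_set1.
Qed.

HB.instance Definition _ :=
  Lmodule_isNormed.Build R L1 ler_norm1D norm1Z norm1_eq0.

End l1_norm.
Arguments L1 : clear implicits.

Definition L1_borel (R : realType) d := g_sigma_algebraType (@open (L1 R d)).

(* Random elements of L1 are only almost surely summable tensor series; on the
   exceptional null set they are given the value 0. *)
Definition to_L1 (R : realType) d (x : tensor_series R d) : L1_borel R d :=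
  insubd (0 : L1 R d) x.

Section sub_sigma_algebras.
Context {disp : measure_display} {T : measurableType disp} {R : realType}.
Variable P : probability T R.
Implicit Types (G H : set (set T)) (X Y : T -> R).

Definition measurable_wrt G X :=
  forall B : set R, measurable B -> G (X @^-1` B).

Definition sigma_gen (I : Type) (X : I -> T -> R) : set (set T) :=
  <<s [set A | exists i (B : set R), measurable B /\ A = X i @^-1` B] >>.

Definition independent2 G H :=
  forall A B, G A -> H B -> P (A `&` B) = (P A * P B)%E.

Definition mutually_independent (I : finType) (G : I -> set (set T)) :=
  forall (J : {set I}) (A : I -> set T), (forall i, i \in J -> G i (A i)) ->
    P (\bigcap_(i in [set` J]) A i) = (\prod_(i in J) P (A i))%E.

Definition is_cond_exp G X Y :=
  [/\ measurable_wrt G Y, P.-integrable setT (EFin \o Y) &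
      forall A, G A -> (\int[P]_(w in A) (Y w)%:E = \int[P]_(w in A) (X w)%:E)%E].

(* A version of E[X | G]; by is_cond_exp_cond_exp below the default value is
   not used when X is integrable and G is a sub-sigma-algebra. *)
Definition cond_exp G X : T -> R := xget (cst 0) [set Y | is_cond_exp G X Y].

Section cond_exp_exists.
Variable G : set (set T).
Hypotheses (sG : sigma_algebra setT G) (GT : G `<=` measurable).

Let TG := g_sigma_algebraType G.

Let mTG (A : set T) : (measurable : set (set TG)) A = G A.
Proof. by rewrite /measurable/= (sigma_algebra_id sG). Qed.

Let mid : measurable_fun setT (id : T -> TG).
Proof. by move=> _ A; rewrite mTG setTI => /GT. Qed.

Let toTG : {mfun T >-> TG} :=
  HB.pack (id : T -> TG) (isMeasurableFun.Build _ _ T TG id mid).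

Let PG : probability TG R := distribution P toTG.

Lemma is_cond_exp_cond_exp X : P.-integrable setT (EFin \o X) ->
  is_cond_exp G X (cond_exp G X).
Proof.
move=> iX.
suff [Y hY] : exists Y, is_cond_exp G X Y.
  exact: (xgetPex (cst 0) (ex_intro _ Y hY)).
pose nu (A : set TG) : \bar R := (\int[P]_(w in A) (X w)%:E)%E.
have nu0 : nu set0 = 0%E by exact: integral_set0.
have nufin A : measurable A -> nu A \is a fin_num.
  by rewrite mTG => /GT mA; exact: (fin_num_measure (induced_charge iX)).
have nusigma : semi_sigma_additive nu.
  move=> F mF tF mUF; rewrite mTG in mUF.
  apply: (@charge_semi_sigma_additive _ T R (induced_charge iX) F) => //.
    by move=> n; apply: GT; rewrite -mTG; exact: mF.
  exact: GT.
pose nuC := isCharge.Build _ _ _ nu nu0 nufin nusigma.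
pose nu' : {charge set TG -> \bar R} := HB.pack nu nuC.
have nuPG : nu' `<< PG.
  apply/null_content_dominatesP => A; rewrite mTG => /GT mA PA0.
  apply: (@null_set_integral _ T R P A) => //.
  by move: (measurable_int P iX) => /(measurable_funS measurableT); exact.
pose g := Radon_Nikodym nu' PG.
have gfin x : g x \is a fin_num by exact: Radon_Nikodym_fin_num.
have ig : PG.-integrable setT g by exact: Radon_Nikodym_integrable.
have fineg : EFin \o (fine \o g) = g by apply/funext => x /=; rewrite fineK.
have mg : measurable_fun setT g by exact: measurable_int ig.
have igP : P.-integrable setT (g \o toTG).
  apply/integrableP; split; first exact: measurableT_comp mg mid.
  have /integrableP[_] := ig.
  rewrite /PG/= ge0_integral_pushforward//.
  exact: measurableT_comp.
exists (fine \o g); split; last first.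
- move=> A GA; have mA : measurable (A : set TG) by rewrite mTG.
  have := Radon_Nikodym_integral nuPG mA.
  rewrite [LHS]/= => nuA; rewrite [RHS]nuA.
  rewrite integral_pushforward//; last first.
    apply: integrableS igP => //; exact: GT.
  by apply: eq_integral => x _; rewrite -[RHS]/(g x) -{2}fineg.
- by rewrite fineg.
- move=> B mB; rewrite -mTG -[X in measurable X]setTI.
  have mfg : measurable_fun setT (fine \o g : TG -> R).
    exact: measurableT_comp.
  exact: mfg.
Qed.
End cond_exp_exists.
End sub_sigma_algebras.

Section brownian_motion.
Context {disp : measure_display} {T : measurableType disp} {R : realType}.
Variable P : probability T R.

Record filtration (F : R -> set (set T)) : Prop := {
  filtration_sigma : forall t, sigma_algebra setT (F t);
  filtration_measurable : forall t, F t `<=` measurable;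
  filtration_incr : forall s t, s <= t -> F s `<=` F t }.

(* normal_prob m 0 is the null measure, so that variance 0 is treated apart. *)
Definition centered_normal (sigma : R) (A : set R) : \bar R :=
  if sigma == 0 then \d_(0 : R) A else normal_prob 0 sigma A.

(* sigma is the standard deviation. *)
Definition has_centered_normal_law (sigma : R) (X : T -> R) :=
  forall A : set R, measurable A -> P (X @^-1` A) = centered_normal sigma A.

Definition centered_gaussian_process (I : Type) (X : I -> T -> R) :=
  forall (n : nat) (c : 'I_n -> R) (i : 'I_n -> I),
    exists sigma, has_centered_normal_law sigma
      (fun w => \sum_(k < n) c k * X (i k) w).

(* F t only contains the information on the increments up to time t: since
   W 0 = 0, the value of W t itself is not F t-measurable for t < 0. *)
Record two_sided_brownian_motion (d : nat) (F : R -> set (set T))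
    (W : R -> 'I_d -> {RV P >-> R}) : Prop := {
  tsbm_gaussian : centered_gaussian_process
    (fun ti : R * 'I_d => W ti.1 ti.2 : T -> R);
  tsbm_continuous : {ae P, forall w, forall i, continuous (fun t => W t i w)};
  tsbm_start : {ae P, forall w, forall i, W 0 i w = 0};
  tsbm_independent_components : mutually_independent P
    (fun i : 'I_d => sigma_gen (fun t : R => W t i : T -> R));
  tsbm_increment_law : forall s t i, 0 < t ->
    has_centered_normal_law (Num.sqrt t) (fun w => W (s + t) i w - W s i w);
  tsbm_increment_independent : forall s t, 0 < t ->
    independent2 P
      (sigma_gen (fun (i : 'I_d) w => W (s + t) i w - W s i w)) (F s);
  tsbm_increment_adapted : forall r u t i, r <= u -> u <= t ->
    measurable_wrt (F t) (fun w => W u i w - W r i w) }.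

End brownian_motion.

Section stratonovich.
Context {disp : measure_display} {T : measurableType disp} {R : realType}.
Variable P : probability T R.
Implicit Types (X Y : R -> T -> R) (a b : R) (Z : T -> R).

Definition mesh a b (p : seq R) : R :=
  \big[Num.max/0]_(k < size p) (nth b (a :: p) k.+1 - nth b (a :: p) k).

Definition partition_sum (phi : R -> R -> T -> R) a b (p : seq R) (w : T) : R :=
  \sum_(k < size p) phi (nth b (a :: p) k) (nth b (a :: p) k.+1) w.

(* Partitions are encoded as in itv_partition: the left end point a is not
   listed in p. *)
Definition partition_sums_cvg (phi : R -> R -> T -> R) a b Z :=
  forall eps eta : R, 0 < eps -> 0 < eta ->
  exists2 delta : R, 0 < delta & forall p : seq R,
    itv_partition a b p -> mesh a b p < delta ->
    (P [set w : T | (eps <= `|partition_sum phi a b p w - Z w|)%R] < eta%:E)%E.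

(* Integral of a continuous semimartingale X against a continuous
   semimartingale Y, as the limit in probability of left-point sums. *)
Definition is_ito_integral X Y a b Z :=
  partition_sums_cvg (fun u v w => X u w * (Y v w - Y u w)) a b Z.

Definition is_covariation X Y a b Z :=
  partition_sums_cvg (fun u v w => (X v w - X u w) * (Y v w - Y u w)) a b Z.

Definition is_stratonovich_integral X Y a b Z :=
  exists I C : {RV P >-> R},
    [/\ is_ito_integral X Y a b I, is_covariation X Y a b C &
        {ae P, forall w, Z w = I w + 2^-1 * C w}].

Definition is_improper_stratonovich_integral X Y b Z :=
  exists J : R -> {RV P >-> R},
    (forall a, a < b -> is_stratonovich_integral X Y a b (J a)) /\
    forall eps : R, 0 < eps ->
      P [set w | eps <= `|J a w - Z w|] @[a --> -oo] --> 0%E.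

End stratonovich.

Section efm_signature.
Context {disp : measure_display} {T : measurableType disp} {R : realType}.
Variables (P : probability T R) (d : nat).

Definition time_extension (W : R -> 'I_d -> {RV P >-> R}) (i : 'I_d.+1)
    (t : R) (w : T) : R :=
  if unlift ord0 i is Some j then W t j w else t.

Definition word_rate (lambda : 'I_d.+1 -> R) (v : word d) : R :=
  \sum_(i <- v) lambda i.

Definition is_efm_signature (lambda : 'I_d.+1 -> R)
    (W : R -> 'I_d -> {RV P >-> R}) (S : R -> word d -> {RV P >-> R}) :=
  (forall t, {ae P, forall w, S t [::] w = 1}) /\
  forall t (v : word d) (i : 'I_d.+1),
    is_improper_stratonovich_integral P
      (fun u w => expR (- word_rate lambda (rcons v i) * (t - u)) * S u v w)
      (time_extension W i) t (S t (rcons v i)).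

Definition series_at (S : R -> word d -> {RV P >-> R}) (t : R) (w : T) :
  tensor_series R d := fun v => S t v w.

End efm_signature.

(* Main.v *)
Require Import Defs.
From HB Require Import structures.
From mathcomp Require Import all_boot all_order all_algebra.
From mathcomp Require Import all_classical all_reals all_analysis.
From mathcomp Require Import measurable_realfun.
From mathcomp Require Import ring lra.

Set Implicit Arguments.
Unset Strict Implicit.
Unset Printing Implicit Defensive.

Import Order.TTheory GRing.Theory Num.Theory.
Import numFieldNormedType.Exports.

Local Open Scope classical_set_scope.
Local Open Scope ring_scope.

(** Why the theorem is true. Fix s <= t. Splitting the improper integral that
    defines a component of the signature at time s gives
      S_t^(v i) = e^(- r (t - s)) S_s^(v i) + M,   r the rate of the word v i,
    where M is the Stratonovich integral of the discounted S^v over [s, t].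
    By induction on the length of the word, S_t is therefore a function of S_s
    and of the increments of W after time s. The first is known at time s, and
    the increments after s are independent of F s. Averaging over independent
    information leaves a function of S_s alone, whence the Markov property.
    All that matters about this function is that it is measurable with respect
    to the sigma-algebra generated by S_s and the increments.

    The signature is determined only up to null sets, whereas the filtration
    need not contain them. All sigma-algebras are therefore completed by the
    null sets (null_augment), inside which almost sure equality and limits in
    probability preserve measurability (measurable_wrt_ae,
    measurable_wrt_limit_prob). This makes neither conditional expectations nor
    independence different (is_cond_exp_null_augment,
    independent_null_augment).

    Four facts carry the proof. A Stratonovich integral is a limit in
    probability of trapezoidal sums over fine partitions; concatenating
    partitions of [a, s] and [s, t] exhibits M as such a limit
    (efm_increment_sums), and the induction over words is
    measurable_efm_past and measurable_efm_future. The whole family of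
    increments after s is independent of F s (independent_future_increments).
    The Borel sets of the separable space of summable series are generated by
    the coordinates (measurable_L1), so that the induction over words speaks
    about the signature as a random element. Finally, if X depends on
    information G contained in F and on information independent of F, then
    E[X | F] = E[X | G] (is_cond_exp_independent_join). *)

(** * Sub-sigma-algebras and null sets *)

Section null_augmentation.
Context {disp : measure_display} {T : measurableType disp} {R : realType}.
Variable P : probability T R.
Implicit Types (G K : set (set T)) (X Y : T -> R) (A B N : set T).

Lemma sub_sigma_algebraT K : sigma_algebra setT K -> K setT.
Proof. by move=> [K0 KC _]; rewrite -(setD0 setT); exact: KC. Qed.

Lemma sub_sigma_algebraC K A : sigma_algebra setT K -> K A -> K (~` A).
Proof. by move=> [_ KC _] KA; rewrite -setTD; exact: KC. Qed.

Lemma sub_sigma_algebraU K A B :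
  sigma_algebra setT K -> K A -> K B -> K (A `|` B).
Proof.
move=> [K0 KC KU] KA KB; rewrite -bigcup2E; apply: KU.
by move=> [|[|n]].
Qed.

Lemma sub_sigma_algebraI K A B :
  sigma_algebra setT K -> K A -> K B -> K (A `&` B).
Proof.
move=> sK KA KB; rewrite -[A `&` B]setCK setCI.
by apply: sub_sigma_algebraC => //; apply: sub_sigma_algebraU => //;
  exact: sub_sigma_algebraC.
Qed.

Lemma sub_sigma_algebraE K : sigma_algebra setT K ->
  (measurable : set (set (g_sigma_algebraType K))) = K.
Proof. by move=> sK; rewrite /measurable/= (sigma_algebra_id sK). Qed.

(** Gives access to the calculus of measurable functions on a measurable space
    for measurability with respect to a sub-sigma-algebra. *)
Lemma measurable_wrtP K X : sigma_algebra setT K ->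
  measurable_wrt K X <->
  measurable_fun setT (X : g_sigma_algebraType K -> R).
Proof.
move=> sK; split=> mX.
- by move=> _ B mB; rewrite setTI sub_sigma_algebraE//; exact: mX.
- by move=> B mB; have := mX measurableT B mB; rewrite setTI sub_sigma_algebraE.
Qed.

Lemma measurable_wrtT X : measurable_wrt measurable X <-> measurable_fun setT X.
Proof.
split=> mX; first by move=> _ B mB; rewrite setTI; exact: mX.
by move=> B mB; rewrite -[_ @^-1` _]setTI; exact: mX.
Qed.

Lemma measurable_wrt_sub G K X : G `<=` K ->
  measurable_wrt G X -> measurable_wrt K X.
Proof. by move=> GK mX B /mX/GK. Qed.

Lemma measurable_wrt_fun K X : K `<=` measurable ->
  measurable_wrt K X -> measurable_fun setT X.
Proof. by move=> Km /(measurable_wrt_sub Km) /measurable_wrtT. Qed.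

Section measurable_wrt_operations.
Variable K : set (set T).
Hypothesis sK : sigma_algebra setT K.

Lemma measurable_wrt_cst (c : R) : measurable_wrt K (cst c).
Proof. by apply/(measurable_wrtP _ sK); exact: measurable_cst. Qed.

Lemma measurable_wrt_indic A : K A -> measurable_wrt K (\1_A : T -> R).
Proof.
move=> KA; apply/(measurable_wrtP _ sK); apply: measurable_indic.
by rewrite sub_sigma_algebraE.
Qed.

Lemma measurable_wrtD X Y : measurable_wrt K X -> measurable_wrt K Y ->
  measurable_wrt K (fun w => X w + Y w).
Proof.
move=> /(measurable_wrtP _ sK) mX /(measurable_wrtP _ sK) mY.
by apply/(measurable_wrtP _ sK); exact: measurable_funD.
Qed.

Lemma measurable_wrtB X Y : measurable_wrt K X -> measurable_wrt K Y ->
  measurable_wrt K (fun w => X w - Y w).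
Proof.
move=> /(measurable_wrtP _ sK) mX /(measurable_wrtP _ sK) mY.
by apply/(measurable_wrtP _ sK); exact: measurable_funB.
Qed.

Lemma measurable_wrtM X Y : measurable_wrt K X -> measurable_wrt K Y ->
  measurable_wrt K (fun w => X w * Y w).
Proof.
move=> /(measurable_wrtP _ sK) mX /(measurable_wrtP _ sK) mY.
by apply/(measurable_wrtP _ sK); exact: measurable_funM.
Qed.

End measurable_wrt_operations.

Lemma measurable_sigma_algebra : sigma_algebra setT (@measurable _ T).
Proof.
split; [exact: measurable0| |exact: bigcupT_measurable].
by move=> A mA; rewrite setTD; exact: measurableC.
Qed.

(** Only measurable null sets are included: the underlying space itself need not
    be complete. *)
Record null_complete K : Prop := {
  null_complete_sigma : sigma_algebra setT K;
  null_complete_sub : K `<=` measurable;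
  null_complete_null : forall N, measurable N -> P N = 0%E -> K N }.

Lemma measurable_wrt_ae K X Y : null_complete K -> measurable_fun setT X ->
  {ae P, forall w, X w = Y w} -> measurable_wrt K Y -> measurable_wrt K X.
Proof.
move=> [sK Km Kn] mX [N [mN PN XYN]] mY B mB.
have -> : X @^-1` B = (X @^-1` B `&` N) `|` (Y @^-1` B `&` ~` N).
  apply/seteqP; split=> w /=.
    move=> XB; have [Nw|Nw] := pselect (N w); [by left|right; split=> //].
    by rewrite -(contra_notP (@XYN w) Nw).
  by move=> [[]//|[YB Nw]]; rewrite (contra_notP (@XYN w) Nw).
apply: sub_sigma_algebraU => //; last first.
  apply: sub_sigma_algebraI => //; first exact: mY.
  by apply: sub_sigma_algebraC => //; exact: Kn.
have mXN : measurable (X @^-1` B `&` N).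
  by apply: measurableI => //; rewrite -[_ @^-1` _]setTI; exact: mX.
apply: Kn => //; exact: (subset_measure0 mXN mN (@subIsetr _ _ _) PN).
Qed.

Definition null_augment G : set (set T) :=
  [set A | measurable A /\ exists2 B, G B &
    exists2 N, measurable N /\ P N = 0%E & A `&` ~` N = B `&` ~` N].

Lemma setI_eq_off A B N w :
  A `&` ~` N = B `&` ~` N -> ~ N w -> A w -> B w.
Proof.
by move=> AB Nw Aw; have /seteqP[+ _] := AB => /(_ w (conj Aw Nw))[].
Qed.

Lemma sub_null_augment G : G `<=` measurable -> G `<=` null_augment G.
Proof.
move=> Gm A GA; split; first exact: Gm.
by exists A => //; exists set0 => //; split; rewrite ?measure0.
Qed.

Lemma null_augment_complete G : sigma_algebra setT G -> G `<=` measurable ->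
  null_complete (null_augment G).
Proof.
move=> sG Gm; split.
- split.
  + by apply: sub_null_augment => //; case: sG.
  + move=> A [mA [B GB [N Nn AB]]].
    split; first by rewrite setTD; exact: measurableC.
    exists (~` B); first exact: sub_sigma_algebraC.
    exists N => //; rewrite setTD.
    apply/seteqP; split=> w [/= nAw Nw]; split=> //.
      by move=> Bw; apply: nAw; exact: setI_eq_off (esym AB) Nw Bw.
    by move=> Aw; apply: nAw; exact: setI_eq_off AB Nw Aw.
  + move=> A GA; split; first by apply: bigcupT_measurable => n; case: (GA n).
    have /choice[B GB] : forall n, exists B, G B /\
       exists2 N, measurable N /\ P N = 0%E & A n `&` ~` N = B `&` ~` N.
      by move=> n; have [_ [B GB hN]] := GA n; exists B.
    have /choice[N Nn] : forall n, exists N, [/\ measurable N, P N = 0%E &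
        A n `&` ~` N = B n `&` ~` N].
      by move=> n; have [_ [N [mN PN] hN]] := GB n; exists N.
    exists (\bigcup_n B n); first by case: sG => _ _; apply=> n; case: (GB n).
    exists (\bigcup_n N n).
      split; first by apply: bigcupT_measurable => n; case: (Nn n).
      apply/negligibleP; first by apply: bigcupT_measurable => n; case: (Nn n).
      apply: negligible_bigcup => n; have [mN PN _] := Nn n.
      exact/negligibleP.
    apply/seteqP; split=> w [[n _ Hw] Nw]; split=> //; exists n => //;
      (have [_ _ AB] := Nn n);
      (have Nnw : ~ N n w by move=> Nnw; apply: Nw; exists n).
      exact: setI_eq_off AB Nnw Hw.
    exact: setI_eq_off (esym AB) Nnw Hw.
- by move=> A [].
- move=> N mN PN; split=> //; exists set0; first by case: sG.
  by exists N => //; rewrite setICr set0I.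
Qed.

Lemma null_augment_min G K : G `<=` measurable -> null_complete K ->
  G `<=` K -> null_augment G `<=` K.
Proof.
move=> Gm [sK Km Kn] GK A [mA [B GB [N [mN PN] AB]]].
have KN : K N by exact: Kn.
have -> : A = (A `&` N) `|` (B `&` ~` N).
  by rewrite -AB -setIUr setUv setIT.
apply: sub_sigma_algebraU => //; last first.
  apply: sub_sigma_algebraI => //; first exact: GK.
  exact: sub_sigma_algebraC.
have mAN : measurable (A `&` N) by exact: measurableI.
apply: Kn => //; exact: subset_measure0 mAN mN (@subIsetr _ _ _) PN.
Qed.

(** The intersections form a pi-system generating the join. *)
Definition intersections G K : set (set T) :=
  [set D | exists A B, [/\ G A, K B & D = A `&` B]].

Lemma setI_closed_intersections G K :
  sigma_algebra setT G -> sigma_algebra setT K ->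
  setI_closed (intersections G K).
Proof.
move=> sG sK _ _ [A1 [B1 [GA1 KB1 ->]]] [A2 [B2 [GA2 KB2 ->]]].
exists (A1 `&` A2), (B1 `&` B2); rewrite setIACA.
by split=> //; exact: sub_sigma_algebraI.
Qed.

Lemma intersections_measurable G K : G `<=` measurable -> K `<=` measurable ->
  intersections G K `<=` measurable.
Proof.
by move=> Gm Km _ [A [B [/Gm mA /Km mB ->]]]; exact: measurableI.
Qed.

Lemma join_sub_intersections G K :
  sigma_algebra setT G -> sigma_algebra setT K ->
  <<s G `|` K>> `<=` <<s intersections G K>>.
Proof.
move=> sG sK; apply: smallest_sub; first exact: smallest_sigma_algebra.
move=> A [GA|KA]; apply: sub_sigma_algebra.
  by exists A, setT; rewrite setIT; split=> //; exact: sub_sigma_algebraT.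
by exists setT, A; rewrite setTI; split=> //; exact: sub_sigma_algebraT.
Qed.

End null_augmentation.

(** * Bounded test functions and conditional expectations *)

Section test_functions.
Context {disp : measure_display} {T : measurableType disp} {R : realType}.
Variable P : probability T R.
Implicit Types (G K : set (set T)) (U X Y phi : T -> R) (A B C N : set T).

Local Notation integ X := (P.-integrable setT (EFin \o X)).

Lemma integrable_mul_bounded U phi (M : R) : integ U ->
  measurable_fun setT phi -> (forall w, `|phi w| <= M) ->
  integ (fun w => U w * phi w).
Proof.
move=> iU mphi bphi.
have -> : EFin \o (fun w => U w * phi w) = ((EFin \o U) \* (EFin \o phi))%E.
  by apply/funext => w /=; rewrite EFinM.
apply: integrableMl => //; exists M; split; first exact: num_real.
by move=> x Mx w _; exact: le_trans (bphi w) (ltW Mx).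
Qed.

Lemma integrable_mul_indic U A : integ U -> measurable A ->
  integ (fun w => U w * \1_A w).
Proof.
move=> iU mA; apply: (@integrable_mul_bounded _ _ 1) => //.
by move=> w; rewrite ger0_norm indicE; case: (w \in A).
Qed.

Lemma integrable_bounded phi (M : R) :
  measurable_fun setT phi -> (forall w, `|phi w| <= M) -> integ phi.
Proof.
move=> mphi bphi; apply: measurable_bounded_integrable => //.
  by rewrite -ge0_fin_numE ?fin_num_measure.
exists M; split; first exact: num_real.
by move=> x Mx w _; exact: le_trans (bphi w) (ltW Mx).
Qed.

Lemma integrable_measurable X : integ X -> measurable_fun setT X.
Proof. by move=> /(measurable_int P) /measurable_EFinP. Qed.

(** Integrals over sets become real expectations against an indicator, the
    simplest of the test functions below. *)
Lemma integral_set_indic X A : integ X -> measurable A ->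
  (\int[P]_(w in A) (X w)%:E = (\int[P]_w (X w * \1_A w)%R)%:E)%E.
Proof.
move=> iX mA; rewrite integral_mkcond -[X in X%:E]/(fine _) fineK; last first.
  exact: integrable_fin_num (integrable_mul_indic iX mA).
apply: eq_integral => w _; rewrite patchE indicE.
by case: ifPn => _; rewrite ?mulr1 ?mulr0.
Qed.

(** Up to 1, x is the number of naturals k below x. After rescaling, this
    approximates a bounded function uniformly by a combination of indicators of
    its superlevel sets. *)
Lemma layer_count (x : R) (n : nat) : 0 <= x <= n%:R ->
  `|x - \sum_(k < n) (k%:R < x)%R%:R| <= 1.
Proof.
elim: n => [|n IHn] /andP[x0 xn].
  by rewrite big_ord0 subr0 ger0_norm// (le_trans xn).
rewrite big_ord_recr/=; have [xn'|nx] := leP x n%:R.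
  by rewrite addr0 IHn// x0.
rewrite (eq_bigr (fun=> 1)) => [|k _]; last first.
  by rewrite (lt_trans _ nx)// ltr_nat.
rewrite sumr_const card_ord.
move: xn; rewrite -natr1 => xn; rewrite (_ : true%:R = 1 :> R)//.
by rewrite ler_norml; apply/andP; split; lra.
Qed.

Lemma le_forall_divn (x c : R) : 0 <= c ->
  (forall n : nat, x <= c / n.+1%:R) -> x <= 0.
Proof.
move=> c0 xc; rewrite leNgt; apply/negP => x0.
pose n := Num.truncn (c / x).
have : c / x < n.+1%:R by apply: truncnS_gt.
have := xc n.
rewrite ler_pdivlMr ?ltr0n// ltr_pdivrMr// mulrC => h1 h2.
by have := lt_le_trans h2 h1; rewrite ltxx.
Qed.

(** Sets suffice to test a function against all bounded functions: the
    superlevel sets give a uniform approximation of the test function. *)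
Lemma integral_test0 K U phi (M : R) : sigma_algebra setT K ->
  K `<=` measurable ->
  integ U -> (forall A, K A -> \int[P]_w (U w * \1_A w) = 0) ->
  measurable_wrt K phi -> (forall w, `|phi w| <= M) ->
  \int[P]_w (U w * phi w) = 0.
Proof.
move=> sK Km iU U0 Kphi bphi.
(* shift phi to a nonnegative function psi, which changes nothing since U has
   integral 0 *)
have mphi := measurable_wrt_fun Km Kphi.
pose psi w := phi w + `|M|.
have psi0 w : 0 <= psi w <= 2 * `|M|.
  have := le_trans (bphi w) (ler_norm M); rewrite ler_norml /psi => /andP[? ?].
  by apply/andP; split; lra.
have mpsi : measurable_fun setT psi by exact: measurable_funD.
have bpsi w : `|psi w| <= 2 * `|M|.
  by have /andP[? ?] := psi0 w; rewrite ger0_norm.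
pose c := 2 * `|M| + 1; have c0 : 0 < c by rewrite ltr_wpDl// mulr_ge0.
have iUpsi : integ (fun w => U w * psi w).
  exact: integrable_mul_bounded mpsi bpsi.
suff Upsi0 : \int[P]_w (U w * psi w) = 0.
  rewrite (eq_Rintegral _ (g := fun w => U w * psi w - U w * `|M|)); last first.
    by move=> w _; rewrite /psi; ring.
  rewrite RintegralB//; last first.
    by apply: integrable_mul_bounded => // w; rewrite normr_id.
  rewrite Upsi0 sub0r RintegralZr//.
  rewrite (_ : \int[P]_x U x = 0) ?mul0r ?oppr0//.
  rewrite -(U0 setT); last exact: sub_sigma_algebraT.
  by apply: eq_Rintegral => w _; rewrite indicT mulr1.
apply/eqP; rewrite -normr_le0.
apply: (@le_forall_divn _ (c * \int[P]_w `|U w|)).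
  by apply: mulr_ge0; [exact: ltW|exact: Rintegral_ge0].
(* q is the layer approximation of psi with n.+1 levels *)
move=> n; pose e := c / n.+1%:R.
have e0 : 0 < e by rewrite divr_gt0.
pose L k := [set w | k%:R * e < psi w].
have KL k : K (L k).
  have -> : L k = phi @^-1` `]k%:R * e - `|M|, +oo[%classic.
    by apply/seteqP; split=> w; rewrite /L/psi/= in_itv/= andbT ltrBlDr.
  exact: Kphi.
pose q w := \sum_(k < n.+1) e * \1_(L k) w.
have qpsi w : `|psi w - q w| <= e.
  have -> : psi w - q w =
      e * (psi w / e - \sum_(k < n.+1) (k%:R < psi w / e)%R%:R).
    rewrite mulrBr mulrCA mulfV ?gt_eqF// mulr1 mulr_sumr; congr (_ - _).
    by apply: eq_bigr => k _; rewrite indicE mem_setE /= ltr_pdivlMr.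
  rewrite normrM gtr0_norm// (ler_piMr (ltW e0))// layer_count//.
  have /andP[p0 p1] := psi0 w; rewrite (divr_ge0 p0 (ltW e0))/=.
  rewrite ler_pdivrMr// /e mulrCA mulfV ?mulr1// (le_trans p1)//.
  by rewrite /c lerDl.
have mq : measurable_fun setT q.
  apply: measurable_sum => k; apply: measurable_funM => //.
  exact/measurable_indic/Km.
have iUq : integ (fun w => U w * q w).
  rewrite /q; have : integ (fun w => \sum_(k < n.+1) U w * (e * \1_(L k) w)).
    rewrite (_ : _ \o _ = fun w =>
        (\sum_(k < n.+1) (U w * (e * \1_(L k) w))%:E)%E).
      apply: integrable_sum => // k _.
      have := integrable_mul_indic iU (Km _ (KL k)).
      move=> /(integrableZl measurableT e); apply: eq_integrable => // w _ /=.
      by rewrite -EFinM; congr EFin; ring.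
    by apply/funext => w /=; rewrite sumEFin.
  apply: eq_integrable => // w _ /=; congr EFin.
  by rewrite mulr_sumr.
have Uq0 : \int[P]_w (U w * q w) = 0.
  rewrite /Rintegral (eq_integral (fun w =>
      (\sum_(k < n.+1) (U w * (e * \1_(L k) w))%:E)%E)); last first.
    by move=> w _; rewrite /q mulr_sumr sumEFin.
  have iUL (k : 'I_n.+1) : integ (fun w => U w * (e * \1_(L k) w)).
    have := integrable_mul_indic iU (Km _ (KL k)).
    move=> /(integrableZl measurableT e); apply: eq_integrable => // w _ /=.
    by rewrite -EFinM; congr EFin; ring.
  rewrite integral_sum// big1// => k _; rewrite -[LHS]fineK; last first.
    exact: integrable_fin_num (iUL k).
  congr EFin; rewrite -[LHS]/(\int[P]_w (U w * (e * \1_(L k) w))).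
  rewrite (eq_Rintegral _ (g := fun w => e * (U w * \1_(L k) w))).
    rewrite RintegralZl// ?U0 ?mulr0//.
    exact: integrable_mul_indic iU (Km _ (KL k)).
  by move=> w _; ring.
have -> : \int[P]_w (U w * psi w) = \int[P]_w (U w * (psi w - q w)).
  rewrite -[LHS]subr0 -{1}Uq0 -RintegralB//.
  by apply: eq_Rintegral => w _; ring.
have iUd : integ (fun w => U w * (psi w - q w)).
  by apply: (@integrable_mul_bounded _ _ e) => //; exact: measurable_funB.
apply: le_trans (le_normr_Rintegral _ iUd) _ => //.
rewrite -mulrAC -/e -RintegralZl//; last exact: integrable_norm.
apply: le_Rintegral => //.
- exact: integrable_norm.
- have := integrable_norm iU.
  by move=> /(integrableZl measurableT e); apply: eq_integrable.
- by move=> w _; rewrite normrM mulrC ler_wpM2r.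
Qed.

End test_functions.

Section uniqueness_and_bounds.
Context {disp : measure_display} {T : measurableType disp} {R : realType}.
Variable P : probability T R.
Implicit Types (G K : set (set T)) (U V X Y phi : T -> R) (A B N : set T).

Local Notation integ X := (P.-integrable setT (EFin \o X)).

Lemma integrable_sub U V : integ U -> integ V -> integ (fun w => U w - V w).
Proof.
move=> iU iV; rewrite (_ : _ \o _ = (EFin \o U) \- (EFin \o V))%E.
  exact: integrableB.
by apply/funext.
Qed.

Lemma integral_setI_off A B N U : measurable A -> measurable B ->
  measurable N -> P N = 0%E -> A `&` ~` N = B `&` ~` N -> integ U ->
  (\int[P]_(w in A) (U w)%:E = \int[P]_(w in B) (U w)%:E)%E.
Proof.
move=> mA mB mN PN AB iU.
rewrite (negligible_integral mN mA) ?(negligible_integral mN mB)//.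
- by rewrite !setDE AB.
- exact: integrableS iU.
- exact: integrableS iU.
Qed.

Lemma is_cond_exp_null_augment G X Y : G `<=` measurable -> integ X ->
  is_cond_exp P G X Y -> is_cond_exp P (null_augment P G) X Y.
Proof.
move=> Gm iX [mY iY YX]; split=> //.
  exact: measurable_wrt_sub (sub_null_augment _ Gm) mY.
move=> A [mA [B GB [N [mN PN] AB]]].
have mB := Gm _ GB.
have off := integral_setI_off mA mB mN PN AB.
by rewrite off// YX// off.
Qed.

Lemma cond_exp_test G X Y phi (M : R) : sigma_algebra setT G ->
  G `<=` measurable -> integ X -> is_cond_exp P G X Y ->
  measurable_wrt G phi -> (forall w, `|phi w| <= M) ->
  \int[P]_w ((Y w - X w) * phi w) = 0.
Proof.
move=> sG Gm iX [mY iY YX] Gphi bphi.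
apply: (@integral_test0 _ _ _ _ G _ _ M) => //.
  exact: integrable_sub.
move=> A GA; have mA := Gm _ GA.
rewrite (eq_Rintegral _ 
  (g := fun w => Y w * \1_A w - X w * \1_A w)); last first.
  by move=> w _; rewrite mulrBl.
rewrite RintegralB//; [|exact: integrable_mul_indic..].
apply/eqP; rewrite subr_eq0 -eqe.
by rewrite -[eqbLHS]integral_set_indic// -[eqbRHS]integral_set_indic// YX.
Qed.

Lemma ae_eq_of_integral0 X Y U :
  measurable_fun setT X -> measurable_fun setT Y ->
  integ U -> (forall w, `|X w - Y w| <= U w) -> \int[P]_w U w = 0 ->
  {ae P, forall w, X w = Y w}.
Proof.
move=> mX mY iU XYU U0.
have mXY : measurable_fun setT (EFin \o (fun w => X w - Y w)).
  by apply/measurable_EFinP; exact: measurable_funB.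
have : (\int[P]_(w in setT) `|(EFin \o (fun w => X w - Y w)%R) w| = 0)%E.
  apply/eqP; rewrite eq_le integral_ge0// andbT.
  rewrite -[leRHS]/(0%:E) -U0 [leRHS]fineK; last exact: integrable_fin_num.
  apply: ge0_le_integral => //.
  - exact: measurableT_comp.
  - exact: measurable_int iU.
  - by move=> w _ /=; rewrite lee_fin.
move=> /(ae_eq_integral_abs P measurableT mXY) [N [mN PN XYN]].
exists N; split=> // w XYw; apply: XYN => /(_ I) /= [] /eqP.
by rewrite subr_eq0 => /eqP.
Qed.

Lemma measurable_wrt_gt K X (c : R) : measurable_wrt K X ->
  K [set w | c < X w].
Proof.
move=> mX; rewrite (_ : [set _ | _] = X @^-1` `]c, +oo[%classic).
  exact: mX.
by apply/seteqP; split=> w /=; rewrite in_itv/= andbT.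
Qed.

(** The sign of a difference is the test function that turns a vanishing
    integral into a vanishing L1 distance. *)
Lemma measurable_wrt_sg K X : sigma_algebra setT K -> measurable_wrt K X ->
  measurable_wrt K (fun w => Num.sg (X w)).
Proof.
move=> sK mX.
have -> : (fun w => Num.sg (X w)) =
    fun w => \1_[set w | 0 < X w] w - \1_[set w | 0 < - X w] w.
  have inE' (f : T -> R) w : (w \in [set w | 0 < f w]) = (0 < f w).
    by apply/idP/idP; rewrite inE.
  apply/funext => w; rewrite !indicE !inE' oppr_gt0.
  by case: sgrP => _; rewrite ?subrr ?subr0 ?sub0r.
apply: measurable_wrtB => //; apply: measurable_wrt_indic => //;
  apply: measurable_wrt_gt => //.
have -> : (fun w => - X w) = fun w => cst 0 w - X w.
  by apply/funext => w; rewrite sub0r.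
by apply: measurable_wrtB => //; exact: measurable_wrt_cst.
Qed.

Lemma norm_sg_le1 (x : R) : `|Num.sg x| <= 1.
Proof. by rewrite normr_sg; case: eqP. Qed.

Lemma cond_exp_unique G X Y Y' : sigma_algebra setT G -> G `<=` measurable ->
  integ X -> is_cond_exp P G X Y -> is_cond_exp P G X Y' ->
  {ae P, forall w, Y w = Y' w}.
Proof.
move=> sG Gm iX cY cY'; have [mY iY _] := cY; have [mY' iY' _] := cY'.
pose phi w := Num.sg (Y w - Y' w).
have mphi : measurable_wrt G phi.
  by apply: measurable_wrt_sg => //; exact: measurable_wrtB.
have bphi w : `|phi w| <= 1 := norm_sg_le1 _.
have iYX : integ (fun w => Y w - X w) by exact: integrable_sub.
have iY'X : integ (fun w => Y' w - X w) by exact: integrable_sub.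
have mphiT := measurable_wrt_fun Gm mphi.
have iphi U : integ U -> integ (fun w => U w * phi w).
  by move=> iU; exact: integrable_mul_bounded mphiT bphi.
apply: (@ae_eq_of_integral0 _ _
  (fun w => (Y w - X w) * phi w - (Y' w - X w) * phi w)).
- exact: integrable_measurable iY.
- exact: integrable_measurable iY'.
- by apply: integrable_sub; exact: iphi.
- move=> w; rewrite -mulrBl (_ : Y w - X w - (Y' w - X w) = Y w - Y' w).
    by rewrite /phi mulrC -normrEsg.
  by ring.
- rewrite RintegralB//; [|exact: iphi|exact: iphi].
  rewrite (cond_exp_test sG Gm iX cY mphi bphi).
  by rewrite (cond_exp_test sG Gm iX cY' mphi bphi) subrr.
Qed.

Lemma is_cond_exp_ae G X Y Y' : G `<=` measurable -> is_cond_exp P G X Y ->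
  {ae P, forall w, Y' w = Y w} -> measurable_wrt G Y' -> is_cond_exp P G X Y'.
Proof.
move=> Gm [mY iY YX] YY' mY'.
have mYT := measurable_wrt_fun Gm mY; have mYT' := measurable_wrt_fun Gm mY'.
split=> //.
  have /integrableP[mEY intY] := iY.
  apply/integrableP; split; first exact/measurable_EFinP.
  rewrite (ae_eq_integral (abse \o (EFin \o Y)))//.
  - by apply: measurableT_comp => //; exact/measurable_EFinP.
  - exact: measurableT_comp.
  - by apply: filterS YY' => w /= ->.
move=> A GA; rewrite -YX//; apply: ae_eq_integral => //.
- exact: Gm.
- by apply/measurable_EFinP; exact: measurable_funTS.
- by apply/measurable_EFinP; exact: measurable_funTS.
- by apply: filterS YY' => w /= ->.
Qed.

(** Conditioning does not leave the range of a bounded random variable, so that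
    a version can be taken that is bounded everywhere and may serve in turn as
    a test function. *)
Lemma bounded_cond_exp G X (M : R) : sigma_algebra setT G ->
  G `<=` measurable -> measurable_fun setT X -> (forall w, `|X w| <= M) ->
  exists2 Y, is_cond_exp P G X Y & forall w, `|Y w| <= M.
Proof.
move=> sG Gm mX bX.
have iX : integ X by exact: integrable_bounded bX.
have cY := is_cond_exp_cond_exp sG Gm iX.
set Y := cond_exp P G X in cY; have [mY iY _] := cY.
pose Y' w := Num.max (- M) (Num.min M (Y w)).
have mY' : measurable_wrt G Y'.
  apply/(measurable_wrtP _ sG); apply: measurable_maxr => //.
  by apply: measurable_minr => //; exact/(measurable_wrtP _ sG).
have bY' w : `|Y' w| <= M.
  have M0 : 0 <= M by rewrite (le_trans _ (bX w)).
  rewrite /Y' ler_norml le_max lexx/= ge_max ge_min lexx andbT.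
  by rewrite (le_trans _ M0)// oppr_le0.
exists Y' => //; apply: (is_cond_exp_ae Gm cY) => //.
(* as X lies between -M and M, (Y - X) sgn (Y - Y') dominates |Y - Y'| *)
pose phi w := Num.sg (Y w - Y' w).
have mphi : measurable_wrt G phi.
  by apply: measurable_wrt_sg => //; exact: measurable_wrtB.
have bphi w : `|phi w| <= 1 := norm_sg_le1 _.
apply: (@ae_eq_of_integral0 _ _ (fun w => (Y w - X w) * phi w)).
- exact: measurable_wrt_fun mY'.
- exact: measurable_wrt_fun mY.
- apply: (@integrable_mul_bounded _ _ _ P _ _ 1) => //.
  + exact: integrable_sub.
  + exact: measurable_wrt_fun mphi.
- move=> w; rewrite /phi distrC.
  have := bX w; rewrite ler_norml => /andP[X1 X2].
  rewrite /Y' minEle; case: ifPn => MY.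
    rewrite maxEle; case: ifPn => [_|]; last by move=> ?; lra.
    have [->|YM] := eqVneq (Y w) M; first by rewrite subrr sgr0 mulr0 normr0.
    have MltY : 0 < Y w - M by rewrite subr_gt0 lt_neqAle eq_sym YM.
    by rewrite gtr0_sg// mulr1 gtr0_norm// lerB.
  rewrite maxEle; case: ifPn => MY2; first by rewrite subrr sgr0 mulr0 normr0.
  have YltM : Y w - - M < 0 by rewrite subr_lt0 ltNge.
  by rewrite ltr0_sg// ltr0_norm// mulrN1 lerN2 lerB.
- exact: cond_exp_test mphi bphi.
Qed.

End uniqueness_and_bounds.

(** * Conditioning on independent information *)

Section independent_information.
Context {disp : measure_display} {T : measurableType disp} {R : realType}.
Variable P : probability T R.
Implicit Types (G H F S : set (set T)) (U X Z phi : T -> R).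
Implicit Types (A B C D N : set T).

Local Notation integ X := (P.-integrable setT (EFin \o X)).

Lemma g_sigma_algebra_measurable S :
  S `<=` measurable -> <<s S>> `<=` measurable.
Proof.
by move=> Sm; apply: smallest_sub => //; exact: measurable_sigma_algebra.
Qed.

(** Dynkin's pi-lambda theorem for the signed measure with density U. *)
Lemma integral_dynkin0 S U : setI_closed S -> S `<=` measurable -> integ U ->
  (\int[P]_w (U w)%:E = 0)%E ->
  (forall D, S D -> \int[P]_(w in D) (U w)%:E = 0)%E ->
  forall D, <<s S>> D -> (\int[P]_(w in D) (U w)%:E = 0)%E.
Proof.
move=> SI Sm iU UT US; have sm := g_sigma_algebra_measurable Sm.
have iUD D : measurable D -> P.-integrable D (EFin \o U).
  by move=> mD; exact: integrableS iU.
apply: (@dynkin_induction _ (g_sigma_algebraType S)) => //.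
- move=> D sD D0; have mD : measurable (D : set T) by exact: sm.
  have mU : measurable_fun setT U by exact: integrable_measurable iU.
  move: UT; rewrite -(setUv D) integral_setU_EFin//; last 3 first.
  - exact: measurableC.
  - by rewrite setUv.
  - exact/disj_setPCl.
  by rewrite D0 add0e.
- move=> F sF tF F0.
  have mF n : measurable (F n : set T) by exact: sm (sF n).
  rewrite (@integral_bigcup _ T R P F (EFin \o U))//; last first.
    by apply: iUD; exact: bigcupT_measurable.
  by rewrite eseries0// => n _ _; exact: F0.
Qed.

(** Test the centered indicator of B, whose integral over each set of F vanishes
    by independence. *)
Lemma independent_integral H F B phi (M : R) : sigma_algebra setT F ->
  F `<=` measurable -> H `<=` measurable -> independent2 P H F -> H B ->
  measurable_wrt F phi -> (forall w, `|phi w| <= M) ->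
  \int[P]_w (\1_B w * phi w) = fine (P B) * \int[P]_w phi w.
Proof.
move=> sF Fm Hm HF HB mphi bphi; have mB := Hm _ HB.
have mphiT := measurable_wrt_fun Fm mphi.
have iB : integ \1_B by exact: integrable_indic.
have ic : integ (cst (fine (P B))) by exact: finite_measure_integrable_cst.
have : \int[P]_w ((\1_B w - fine (P B)) * phi w) = 0.
  apply: (@integral_test0 _ _ _ _ F _ _ M) => //.
    exact: (integrable_sub iB ic).
  move=> A FA; have mA := Fm _ FA.
  rewrite (eq_Rintegral _
    (g := fun w => \1_(B `&` A) w - fine (P B) * \1_A w)); last first.
    by move=> w _; rewrite mulrBl indicI.
  have iA : integ \1_A by exact: integrable_indic.
  rewrite RintegralB//; last 2 first.
    by apply: integrable_indic; exact: measurableI.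
    have /(integrableZl measurableT (fine (P B))) := iA.
    exact: eq_integrable.
  rewrite RintegralZl// /Rintegral !integral_indic//; last exact: measurableI.
  rewrite !setIT; apply/eqP; rewrite subr_eq0; apply/eqP.
  rewrite -fineM ?fin_num_measure//.
  congr (fine _); exact: (HF _ _ HB FA).
under eq_Rintegral do rewrite mulrBl.
have iphi : integ phi by exact: integrable_bounded bphi.
rewrite RintegralB//; last 2 first.
  exact: integrable_mul_bounded bphi.
  have /(integrableZl measurableT (fine (P B))) := iphi.
  exact: eq_integrable.
by rewrite RintegralZl// => /eqP; rewrite subr_eq0 => /eqP.
Qed.

Lemma independent_null_augment H F : H `<=` measurable -> F `<=` measurable ->
  independent2 P H F -> independent2 P H (null_augment P F).
Proof.
move=> Hm Fm HF A C HA [mC [D FD [N [mN PN] CD]]].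
have mA := Hm _ HA; have mD := Fm _ FD.
have Poff E : measurable E -> P E = P (E `&` ~` N).
  move=> mE; rewrite -setDE measureD//; last first.
    by rewrite ltey_eq fin_num_measure.
  rewrite [X in (_ - X)%E](_ : _ = 0%E) ?sube0//.
  exact: subset_measure0 (measurableI _ _ mE mN) mN (@subIsetr _ _ _) PN.
rewrite (Poff (A `&` C)) ?(Poff C)//; last exact: measurableI.
rewrite -setIA CD setIA -Poff//; last exact: measurableI.
by rewrite -Poff// (HF _ _ HA FD).
Qed.

(** Additional information in F is useless for predicting X beyond G, because X
    only adds to G what is independent of F. For C in F, let g be a version of
    the conditional probability of C given G. Independence shows that g and the
    indicator of C have the same integral over the sets of the join of G and H,
    hence against X. Moving the conditioning from one factor to the other,
    E[1_C X] = E[g X] = E[g Z] = E[1_C Z]. *)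
Lemma is_cond_exp_independent_join G H F X Z (M : R) :
  null_complete P G -> null_complete P F -> G `<=` F ->
  sigma_algebra setT H -> H `<=` measurable -> independent2 P H F ->
  measurable_wrt (null_augment P <<s G `|` H>>) X -> (forall w, `|X w| <= M) ->
  is_cond_exp P G X Z -> (forall w, `|Z w| <= M) ->
  is_cond_exp P F X Z.
Proof.
move=> [sG Gm Gn] [sF Fm Fn] GF sH Hm HF mX bX cZ bZ.
set K := <<s G `|` H>> in mX *.
have Km : K `<=` measurable.
  by apply: g_sigma_algebra_measurable => A [/Gm|/Hm].
have sK : sigma_algebra setT K by exact: smallest_sigma_algebra.
have [sK' K'm _] := null_augment_complete P sK Km.
have mXT := measurable_wrt_fun K'm mX.
have iX : integ X by exact: integrable_bounded bX.
have [mZ iZ _] := cZ.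
have mZT := measurable_wrt_fun Gm mZ.
split=> // [|C FC]; first exact: measurable_wrt_sub mZ.
have mC := Fm _ FC.
have mIC : measurable_fun setT (\1_C : T -> R) by exact: measurable_indic.
have bI A w : `|\1_A w| <= 1 :> R by rewrite ger0_norm indicE; case: (w \in A).
have iC : integ \1_C by exact: integrable_indic.
have [g cg bg] := bounded_cond_exp P sG Gm mIC (bI C).
have [mg ig _] := cg; have mgT := measurable_wrt_fun Gm mg.
have iCg : integ (fun w => \1_C w - g w) by exact: integrable_sub iC ig.
(* B factors out by independence, which leaves the set A of G *)
have Cg_pi A B : G A -> H B ->
    (\int[P]_(w in A `&` B) (\1_C w - g w)%:E = 0)%E.
  move=> GA HB; have mA := Gm _ GA; have mB := Hm _ HB.
  have FA := GF _ GA.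
  rewrite (integral_set_indic iCg); last exact: measurableI.
  congr EFin; rewrite (eq_Rintegral _ (g := fun w =>
    \1_B w * (\1_C w * \1_A w) - \1_B w * (g w * \1_A w))); last first.
    by move=> w _; rewrite indicI /=; ring.
  have mIA : measurable_fun setT (\1_A : T -> R) by exact: measurable_indic.
  have mIB : measurable_fun setT (\1_B : T -> R) by exact: measurable_indic.
  have bM U (V : T -> R) : (forall w, `|U w| <= 1) -> (forall w, `|V w| <= 1) ->
      forall w, `|U w * V w| <= 1.
    by move=> bU bV w; rewrite normrM mulr_ile1.
  have iM U (V : T -> R) : integ U -> measurable_fun setT V ->
      (forall w, `|V w| <= 1) -> integ (fun w => V w * U w).
    move=> iU mV bV; have := integrable_mul_bounded iU mV bV.
    by apply: eq_integrable => // w _ /=; rewrite mulrC.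
  have iB : integ \1_B by exact: integrable_indic.
  rewrite RintegralB//; last 2 first.
  - apply: iM => //; exact: integrable_mul_indic.
  - apply: iM => //; exact: integrable_mul_indic.
  rewrite (independent_integral sF Fm Hm HF HB (M := 1)); last 2 first.
  - by apply: measurable_wrtM => //; exact: measurable_wrt_indic.
  - by apply: bM => //.
  rewrite (independent_integral sF Fm Hm HF HB (M := 1)); last 2 first.
  - apply: measurable_wrtM => //; first exact: measurable_wrt_sub mg.
    exact: measurable_wrt_indic.
  - by apply: bM => //.
  have GIA : measurable_wrt G (\1_A : T -> R) by exact: measurable_wrt_indic.
  have := cond_exp_test sG Gm iC cg GIA (bI A).
  under eq_Rintegral do rewrite mulrBl.
  rewrite RintegralB//; [|exact: integrable_mul_indic..].
  by move=> /eqP; rewrite subr_eq0 => /eqP ->; rewrite subrr.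
have GT := sub_sigma_algebraT sG; have HT := sub_sigma_algebraT sH.
have Cg_K D : K D -> (\int[P]_(w in D) (\1_C w - g w)%:E = 0)%E.
  move=> /(join_sub_intersections sG sH); apply: integral_dynkin0 => //.
  - exact: setI_closed_intersections.
  - exact: intersections_measurable.
  - by have := Cg_pi _ _ GT HT; rewrite setIT.
  - by move=> _ [A [B [GA HB ->]]]; exact: Cg_pi.
have CgX : \int[P]_w ((\1_C w - g w) * X w) = 0.
  apply: (integral_test0 sK' K'm iCg _ mX bX) => A [mA [B KB [N [mN PN] AB]]].
  have mB := Km _ KB.
  apply: EFin_inj; rewrite -(integral_set_indic iCg)//.
  by rewrite (integral_setI_off mA mB mN PN AB iCg) Cg_K.
have CgZ : \int[P]_w ((g w - \1_C w) * Z w) = 0.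
  exact: cond_exp_test sG Gm iC cg mZ bZ.
have gXZ : \int[P]_w ((Z w - X w) * g w) = 0.
  exact: cond_exp_test sG Gm iX cZ mg bg.
rewrite !integral_set_indic//; congr EFin.
apply/eqP; rewrite -subr_eq0 -RintegralB//;
  [|exact: integrable_mul_indic..].
rewrite (eq_Rintegral _ (g := fun w =>
  (Z w - X w) * g w - (g w - \1_C w) * Z w - (\1_C w - g w) * X w)); last first.
  by move=> w _; ring.
have i1 : integ (fun w => (Z w - X w) * g w).
  by apply: integrable_mul_bounded bg => //; exact: integrable_sub.
have i2 : integ (fun w => (g w - \1_C w) * Z w).
  by apply: integrable_mul_bounded bZ => //; exact: integrable_sub ig iC.
have i3 : integ (fun w => (\1_C w - g w) * X w).
  exact: integrable_mul_bounded bX.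
rewrite RintegralB//; last exact: integrable_sub.
by rewrite RintegralB// CgX CgZ gXZ !subrr.
Qed.

End independent_information.

Section independence.
Context {disp : measure_display} {T : measurableType disp} {R : realType}.
Variable P : probability T R.
Implicit Types (G H F S : set (set T)) (A B D : set T) (X Y : T -> R).

(** For A in F, the signed measure with density 1_A - P A vanishes on S. *)
Lemma independent_dynkin S F : setI_closed S -> S `<=` measurable ->
  F `<=` measurable -> independent2 P S F -> independent2 P <<s S>> F.
Proof.
move=> SI Sm Fm SF B A SB FA; have mA := Fm _ FA.
pose U w : R := \1_A w - fine (P A).
have iA : P.-integrable setT (EFin \o (\1_A : T -> R)).
  exact: integrable_indic.
have ic : P.-integrable setT (EFin \o cst (fine (P A))).
  exact: finite_measure_integrable_cst.
have iU : P.-integrable setT (EFin \o U) by exact: integrable_sub iA ic.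
have UE D : measurable D ->
    (\int[P]_(w in D) (U w)%:E = P (D `&` A) - P A * P D)%E.
  move=> mD; rewrite integralB_EFin//; last 2 first.
  - exact: integrableS iA.
  - exact: integrableS ic.
  rewrite integral_indic// setIC integral_cst//.
  by rewrite fineK ?fin_num_measure.
have PAD D : P (D `&` A) \is a fin_num -> (P D * P A \is a fin_num)%E ->
    (P (D `&` A) - P A * P D = 0)%E <-> (P (D `&` A) = P D * P A)%E.
  move=> fDA fDA'; rewrite [in X in (_ - X)%E]muleC.
  split; last by move=> ->; rewrite subee.
  by move/eqP; rewrite sube_eq ?add0e;
    [move/eqP|by []|exact: fin_num_adde_defl].
have mfin D : measurable D -> P (D `&` A) \is a fin_num.
  by move=> mD; rewrite fin_num_measure//; exact: measurableI.
have mfin' D : measurable D -> (P D * P A \is a fin_num)%E.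
  by move=> mD; rewrite fin_numM ?fin_num_measure.
have mB : measurable B by exact: g_sigma_algebra_measurable SB.
apply/(PAD _ (mfin _ mB) (mfin' _ mB)); rewrite -UE//.
apply: (integral_dynkin0 SI Sm iU) => //.
- by rewrite UE// setTI probability_setT mule1 subee// fin_num_measure.
- move=> D SD; rewrite UE; last exact: Sm.
  by apply/PAD; [exact/mfin/Sm|exact/mfin'/Sm|exact: SF].
Qed.

(** Successive independence: what H2 adds is independent of the past F1, which
    already contains H1. This is how independence of single increments
    propagates to families of them. *)
Lemma independent_join H1 H2 F0 F1 :
  sigma_algebra setT H1 -> sigma_algebra setT H2 -> sigma_algebra setT F1 ->
  H2 `<=` measurable -> F1 `<=` measurable ->
  F0 `<=` F1 -> H1 `<=` F1 ->
  independent2 P H1 F0 -> independent2 P H2 F1 ->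
  independent2 P <<s H1 `|` H2>> F0.
Proof.
move=> s1 s2 sF m2 mF F01 H1F I1 I2.
have m1 : H1 `<=` measurable by move=> A /H1F/mF.
suff IF : independent2 P <<s intersections H1 H2>> F0.
  by move=> A B /(join_sub_intersections s1 s2) HA FB; exact: IF.
apply: independent_dynkin.
- exact: setI_closed_intersections.
- exact: intersections_measurable.
- by move=> A /F01/mF.
move=> _ C [A [B [HA HB ->]]] FC.
have I2AC : P (B `&` (A `&` C)) = (P B * P (A `&` C))%E.
  by apply: I2 => //; apply: sub_sigma_algebraI => //; [exact: H1F|exact: F01].
have I2A : P (B `&` A) = (P B * P A)%E by apply: I2 => //; exact: H1F.
by rewrite [A `&` B]setIC -setIA I2AC I1// I2A muleA.
Qed.

Lemma sub_sigma_gen (I : Type) (Y : I -> T -> R) G : sigma_algebra setT G ->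
  (forall i, measurable_wrt G (Y i)) -> sigma_gen Y `<=` G.
Proof.
move=> sG mY; apply: smallest_sub => // _ [i [B [mB ->]]]; exact: mY.
Qed.

Lemma measurable_sigma_gen (I : Type) (Y : I -> T -> R) i :
  measurable_wrt (sigma_gen Y) (Y i).
Proof. by move=> B mB; apply: sub_sigma_algebra; exists i, B. Qed.

End independence.

(** * Future increments of Brownian motion *)

Section increments.
Context {disp : measure_display} {T : measurableType disp} {R : realType}.
Variables (P : probability T R) (d : nat) (F : R -> set (set T)).
Variable (W : R -> 'I_d -> {RV P >-> R}).
Hypotheses (filtF : filtration F) (WBM : two_sided_brownian_motion F W).
Implicit Types (s u : R) (l : seq R).

Definition increment s (ui : R * 'I_d) (w : T) : R :=
  W ui.1 ui.2 w - W s ui.2 w.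

Definition increments_at s l : set (set T) :=
  sigma_gen (fun ui : {u | u \in l} * 'I_d => increment s (sval ui.1, ui.2)).

Definition future_increments s : set (set T) :=
  sigma_gen (fun ui : {u | s < u} * 'I_d => increment s (sval ui.1, ui.2)).

Lemma measurable_increment s ui : measurable_fun setT (increment s ui).
Proof. exact: measurable_funB. Qed.

Lemma increments_at_measurable s l : increments_at s l `<=` measurable.
Proof.
apply: sub_sigma_gen; first exact: measurable_sigma_algebra.
by move=> ui; apply/measurable_wrtT; exact: measurable_increment.
Qed.

Lemma future_increments_measurable s : future_increments s `<=` measurable.
Proof.
apply: sub_sigma_gen; first exact: measurable_sigma_algebra.
by move=> ui; apply/measurable_wrtT; exact: measurable_increment.
Qed.

Lemma measurable_increments_at s l u i : u \in l ->
  measurable_wrt (increments_at s l) (increment s (u, i)).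
Proof.
move=> ul; exact: (@measurable_sigma_gen _ _ _ _
  (fun ui : {u | u \in l} * 'I_d => increment s (sval ui.1, ui.2))
  (exist _ u ul, i)).
Qed.

Lemma sub_increments_at s l l' : {subset l <= l'} ->
  increments_at s l `<=` increments_at s l'.
Proof.
move=> ll'; apply: sub_sigma_gen; first exact: smallest_sigma_algebra.
by move=> [[u ul] i]; apply: measurable_increments_at; exact: ll'.
Qed.

(** Induction on the times in increasing order: the increment up to the first
    time u is known at time u, and the increments after u are independent of
    what is known then. *)
Lemma independent_increments_path s l : path <%R s l ->
  independent2 P (increments_at s l) (F s).
Proof.
have sF := filtration_sigma filtF; have mF := filtration_measurable filtF.
elim: l s => [s _|u l IHl s /= /andP[su ul]].
  have sub0 : increments_at s [::] `<=` <<s set0>>.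
    by apply: sub_sigma_gen => [|[[]]//]; exact: smallest_sigma_algebra.
  move=> A B /sub0 HA FB.
  by apply: (@independent_dynkin _ _ _ _ set0 (F s)) => //.
pose H1 := sigma_gen (fun (i : 'I_d) w => W (s + (u - s)) i w - W s i w).
have usE : s + (u - s) = u by rewrite addrC subrK.
have sub : increments_at s (u :: l) `<=` <<s H1 `|` increments_at u l>>.
  apply: sub_sigma_gen => [|[[v vl] i]]; first exact: smallest_sigma_algebra.
  have m1 : measurable_wrt <<s H1 `|` increments_at u l>> (increment s (u, i)).
    have : measurable_wrt H1 (increment s (u, i)).
      have -> : increment s (u, i) = fun w => W (s + (u - s)) i w - W s i w.
        by rewrite usE.
      exact: (@measurable_sigma_gen _ _ _ _
        (fun (i : 'I_d) w => W (s + (u - s)) i w - W s i w)).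
    apply: measurable_wrt_sub => A HA; apply: sub_sigma_algebra; by left.
  have := vl; rewrite inE/= => /predU1P[->//|vl'].
  have -> : increment s (v, i) =
      fun w => increment u (v, i) w + increment s (u, i) w.
    by apply/funext => w; rewrite /increment/= addrA subrK.
  apply: (measurable_wrtD _ _ m1); first exact: smallest_sigma_algebra.
  have := @measurable_increments_at u l v i vl'.
  apply: measurable_wrt_sub => A HA; apply: sub_sigma_algebra; by right.
move=> A B /sub HA FB.
have := @independent_join _ _ _ P H1 (increments_at u l) (F s) (F u).
apply => //.
- exact: smallest_sigma_algebra.
- exact: smallest_sigma_algebra.
- exact: increments_at_measurable.
- exact: filtration_incr (ltW su).
- apply: sub_sigma_gen => // i; rewrite usE.
  by apply: (tsbm_increment_adapted WBM) => //; exact: ltW.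
- by apply: (tsbm_increment_independent WBM); rewrite subr_gt0.
- exact: IHl.
Qed.

(** The increments at finite sets of times form a directed family, whose union
    is a pi-system. *)
Lemma independent_future_increments s :
  independent2 P (future_increments s) (F s).
Proof.
pose S := [set A | exists2 l, {in l, forall u, s < u} & increments_at s l A].
have sub : future_increments s `<=` <<s S>>.
  apply: sub_sigma_gen => [|[[u su] i]]; first exact: smallest_sigma_algebra.
  have := @measurable_increments_at s [:: u] u i (mem_head _ _).
  apply: measurable_wrt_sub => A HA; apply: sub_sigma_algebra.
  by exists [:: u] => // v; rewrite inE => /eqP ->.
suff SF : independent2 P <<s S>> (F s) by move=> A B /sub HA FB; exact: SF.
apply: (@independent_dynkin _ _ _ P S (F s)).
- move=> A B [l sl HA] [l' sl' HB]; exists (l ++ l').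
    by move=> u; rewrite mem_cat => /orP[/sl|/sl'].
  apply: (@sub_sigma_algebraI _ _ (increments_at s (l ++ l'))).
  - exact: smallest_sigma_algebra.
  - by apply: sub_increments_at HA => u; rewrite mem_cat => ->.
  - by apply: sub_increments_at HB => u; rewrite mem_cat => ->; rewrite orbT.
- by move=> A [l _ /increments_at_measurable].
- exact: filtration_measurable.
move=> A B [l sl HA] FB; pose l' := sort <=%R (undup l).
apply: (@independent_increments_path s l') => //.
  have sl' : {in l', forall u, s < u}.
    by move=> u; rewrite mem_sort mem_undup => /sl.
  have : sorted <%R l' by rewrite sort_lt_sorted undup_uniq.
  by case: l' sl' => //= u l'' ->//; rewrite mem_head.
by apply: sub_increments_at HA => u; rewrite mem_sort mem_undup.
Qed.

End increments.

(** * Limits in probability *)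

Section convergence_in_probability.
Context {disp : measure_display} {T : measurableType disp} {R : realType}.
Variable P : probability T R.
Implicit Types (K : set (set T)) (X Y Z D Q : T -> R).

Definition deviation (e : R) X : set T := [set w | e <= `|X w|].

Lemma measurable_deviation X (e : R) : measurable_fun setT X ->
  measurable (deviation e X).
Proof.
move=> mX; have -> : deviation e X = (fun w => `|X w|) @^-1` `[e, +oo[%classic.
  by apply/seteqP; split=> w /=; rewrite in_itv/= andbT.
rewrite -[_ @^-1` _]setTI.
have : measurable_fun setT (fun w => `|X w|) by exact: measurableT_comp.
exact.
Qed.

Lemma deviation_add D X Y (e eta : R) :
  measurable_fun setT D -> measurable_fun setT X -> measurable_fun setT Y ->
  {ae P, forall w, `|D w| <= `|X w| + `|Y w|} ->
  (P (deviation (e) X) < eta%:E)%E ->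
  (P (deviation (e) Y) < eta%:E)%E ->
  (P (deviation (e + e)%R D) < (eta + eta)%:E)%E.
Proof.
move=> mD mX mY [N [mN PN DN]] PX PY.
have mDX := measurable_deviation e mX; have mDY := measurable_deviation e mY.
have mDD := measurable_deviation (e + e) mD.
apply: (@le_lt_trans _ _ (P ((deviation e X `|` deviation e Y) `|` N))).
  rewrite le_measure ?inE//.
    by apply: measurableU => //; exact: measurableU.
  move=> w; rewrite /deviation/= => eD.
  have [|Nw] := pselect (N w); [by right|left].
  have := contra_notP (@DN w) Nw => /= le.
  have [eX|Xe] := leP e `|X w|; [by left|right => /=].
  rewrite leNgt; apply/negP => Ye.
  by have := le_lt_trans (le_trans eD le) (ltrD Xe Ye); rewrite ltxx.
apply: (@le_lt_trans _ _ (P (deviation (e) X) + P (deviation (e) Y))%E).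
  rewrite measureU0//; last exact: measurableU.
  exact: measureU2.
by rewrite EFinD lteD.
Qed.

(** Approximations whose errors and exceptional probabilities are summable
    converge almost surely by Borel-Cantelli, and the exceptional null set
    belongs to K. *)
Lemma measurable_wrt_limit_prob K Z : null_complete P K ->
  measurable_fun setT Z ->
  (forall eps eta : R, 0 < eps -> 0 < eta -> exists2 Q, measurable_wrt K Q &
     (P (deviation eps (fun w => Q w - Z w)%R) < eta%:E)%E) ->
  measurable_wrt K Z.
Proof.
move=> cK mZ hZ; have [sK Km Kn] := cK.
pose e n : R := (1 / (2 ^ n.+1)%:R).
have e0 n : 0 < e n by rewrite divr_gt0// ltr0n expn_gt0.
have /choice[Q hQ] : forall n, exists Q, measurable_wrt K Q /\
    (P (deviation (e n) (fun w => Q w - Z w)%R) < (e n)%:E)%E.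
  by move=> n; have [Q ? ?] := hZ _ _ (e0 n) (e0 n); exists Q.
have mQ n := (hQ n).1; have PQ n := (hQ n).2.
pose E n := deviation (e n) (fun w => Q n w - Z w).
have mE n : measurable (E n).
  apply: measurable_deviation; apply: measurable_funB => //.
  exact: measurable_wrt_fun (mQ n).
pose N := lim_sup_set E.
have PN : P N = 0%E.
  apply: lim_sup_set_cvg0 => //.
  apply: (@le_lt_trans _ _ (1 : \bar R)%E); last by rewrite ltry.
  apply: le_trans (epsilon_trick0 xpredT (@ler01 R)).
  by apply: lee_nneseries => // n _; exact: ltW (PQ n).
have mN : measurable N.
  by apply: bigcapT_measurable => n; apply: bigcup_measurable.
have KNC : K (~` N) by apply: sub_sigma_algebraC => //; exact: Kn.
have mNK : measurable_fun setT (\1_(~` N) : g_sigma_algebraType K -> R).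
  by apply: measurable_indic; rewrite sub_sigma_algebraE.
apply: (@measurable_wrt_ae _ _ _ P _ _ (fun w => Z w * \1_(~` N) w)) => //.
  exists N; split=> // w /= ZN; apply: contrapT => Nw; apply: ZN.
  by rewrite indicE mem_set ?mulr1.
apply/(measurable_wrtP _ sK).
apply: (@measurable_fun_cvg _ (g_sigma_algebraType K) R setT
  (fun n w => Q n w * \1_(~` N) w)).
  move=> n; apply: measurable_funM => //.
  exact/(measurable_wrtP _ sK).
move=> w _; rewrite indicE; have [wN|wN] := boolP (w \in ~` N); last first.
  rewrite mulr0 (_ : (fun _ => _) = cst 0)//; first exact: cvg_cst.
  by apply/funext => n; rewrite mulr0.
rewrite mulr1 (_ : (fun _ => _) = Q ^~ w); last first.
  by apply/funext => n; rewrite mulr1.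
move: wN; rewrite inE => wN.
have [m hm] : exists m, forall n, (m <= n)%N -> ~ E n w.
  apply: contrapT => /forallNP hE; apply: wN => m _.
  have /existsNP[n /not_implyP[mn /contrapT En]] := hE m.
  by exists n.
apply/cvgrPdist_lt => eps eps0; near=> n.
have nE : ~ E n w by apply: hm; near: n; exact: nbhs_infty_ge.
rewrite distrC; apply: (@lt_trans _ _ (e n)).
  by rewrite ltNge; apply/negP => /nE.
rewrite /e ltr_pdivrMr ?ltr0n ?expn_gt0// -ltr_pdivrMl// mulr1.
apply: (@lt_trans _ _ n%:R); last first.
  by rewrite ltr_nat (ltn_trans (ltnSn n))// ltn_expl.
near: n; exact: nbhs_infty_gtr.
Unshelve. all: by end_near. Qed.

End convergence_in_probability.

(** * Partition sums *)

Section partitions.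
Context {disp : measure_display} {T : measurableType disp} {R : realType}.
Implicit Types (phi : R -> R -> T -> R) (a b s t : R) (p q : seq R) (w : T).

Lemma partition_sum_nil phi a b w : partition_sum phi a b [::] w = 0.
Proof. by rewrite /partition_sum big_ord0. Qed.

Lemma partition_sum_cons phi a b x p w :
  partition_sum phi a b (x :: p) w = phi a x w + partition_sum phi x b p w.
Proof. by rewrite /partition_sum big_ord_recl. Qed.

Lemma partition_sum_cat phi a s t q p w :
  partition_sum phi a t (q ++ p) w =
  partition_sum phi a s q w + partition_sum phi (last a q) t p w.
Proof.
elim: q a => [a|x q IHq a] /=; first by rewrite partition_sum_nil add0r.
by rewrite !partition_sum_cons IHq addrA.
Qed.

Lemma mesh_lt a b p (delta : R) : 0 < delta ->
  path (fun u v => v - u < delta) a p -> mesh a b p < delta.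
Proof.
by move=> d0 /(pathP b) hp; apply: bigmax_lt => // k _; exact: hp.
Qed.

Lemma fine_partition a b (delta : R) : a < b -> 0 < delta ->
  exists2 p, itv_partition a b p & path (fun u v => v - u < delta) a p.
Proof.
move=> ab d0; pose h := delta / 2.
have h0 : 0 < h by rewrite divr_gt0.
have [m] : exists m : nat, b - a < m%:R * h.
  exists (Num.truncn ((b - a) / h)).+1.
  by rewrite -ltr_pdivrMr//; exact: truncnS_gt.
elim: m a ab => [|m IHm] a ab; first by rewrite mul0r ltNge subr_ge0 ltW.
rewrite -natr1 mulrDl mul1r => abm.
have [bah|hba] := leP (b - a) h.
  exists [:: b]; first by split; rewrite /= ?ab.
  by rewrite /= andbT (le_lt_trans bah)// /h; lra.
have [||p [pp pl] dp] := IHm (a + h); [lra|lra|].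
exists (a + h :: p); last by rewrite /= dp andbT /h; lra.
by split=> //=; rewrite ltrDl h0.
Qed.

Lemma measurable_partition_sum K phi a b p : sigma_algebra setT K ->
  itv_partition a b p ->
  (forall u v, a <= u -> u <= v -> v <= b -> measurable_wrt K (phi u v)) ->
  measurable_wrt K (partition_sum phi a b p).
Proof.
move=> sK; elim: p a => [|x p IHp] a abp mphi.
  rewrite (_ : partition_sum _ _ _ _ = cst 0); first exact: measurable_wrt_cst.
  by apply/funext => w; rewrite partition_sum_nil.
have xbp := itv_partition_cons abp; have xb := itv_partition_le xbp.
have ax : a < x by case: abp => /= /andP[].
rewrite (_ : partition_sum _ _ _ _ =
    fun w => phi a x w + partition_sum phi x b p w).
  apply: measurable_wrtD => //; first by apply: mphi => //; exact: ltW.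
  by apply: IHp => // u v xu; apply: mphi; rewrite (le_trans _ xu)// ltW.
by apply/funext => w; rewrite partition_sum_cons.
Qed.

End partitions.

(** * Borel sets of the space of summable series *)

Section borel_l1.
Context {R : realType} {d : nat}.
Implicit Types (x y : tensor_series R d) (v : word d) (s : seq rat).

(** Coordinates along the enumeration of words by their codes; numbers that code
    no word contribute 0. *)
Definition nth_coord x (k : nat) : R :=
  if pickle_inv k is Some v then x v else 0.

Lemma enorm1_nneseries x :
  enorm1 x = (\sum_(k <oo) `|nth_coord x k|%:E)%E.
Proof.
pose Q k := pickle_inv k != None :> option (word d).
rewrite (eq_eseriesr
    (g := fun k => if Q k then `|nth_coord x k|%:E else 0%E)); last first.
  move=> k _; rewrite /Q /nth_coord; case: (pickle_inv k) => //=.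
  by rewrite normr0.
rewrite -eseries_mkcond nneseries_esum//.
rewrite (@reindex_esum R (word d) nat setT [set k | Q k] pickle).
  by apply: eq_esum => v _; rewrite /nth_coord pickleK_inv.
split => //.
- by move=> v _ /=; rewrite /Q pickleK_inv.
- move=> k /=; rewrite /Q; have := @pickle_invK (word d) k.
  by case: (pickle_inv k) => //= v <- _; exists v.
Qed.

(** The default value 0 of nth makes the support finite. *)
Definition rat_series s : tensor_series R d :=
  fun v => ratr (nth 0 s (pickle v)).

Lemma nth_coord_rat_series s k :
  (size s <= k)%N -> nth_coord (rat_series s) k = 0.
Proof.
rewrite /nth_coord /rat_series; have := @pickle_invK (word d) k.
by case: (pickle_inv k) => //= v -> ks; rewrite nth_default// rmorph0.
Qed.

Lemma rat_series_in_L1 s : rat_series s \in in_L1.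
Proof.
rewrite unfold_in enorm1_nneseries (nneseries_split 0 (size s))//.
rewrite eseries0 => [|k sk _].
  by rewrite adde0 sumEFin ltry.
by rewrite nth_coord_rat_series// normr0.
Qed.

Definition rat_point s : L1 R d := MkL1 (rat_series_in_L1 s).

(** Cut the series where its tail is below e / 2, and round the n remaining
    coordinates to within e / 2 / n.+1 each. *)
Lemma rat_point_dense (x : L1 R d) (e : R) : 0 < e ->
  exists s, norm1 (x - rat_point s) < e.
Proof.
move=> e0; have e20 : 0 < e / 2 by rewrite divr_gt0.
have xfin : (\sum_(0 <= k <oo) `|nth_coord x k|%:E < +oo)%E.
  by rewrite -enorm1_nneseries; exact: L1valP.
have tail : (\sum_(n <= k <oo) `|nth_coord x k|%:E @[n --> \oo] --> 0)%E.
  exact: nneseries_tail_cvg.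
have [n hn] : exists n, (\sum_(n <= k <oo) `|nth_coord x k|%:E < (e / 2)%:E)%E.
  have /tail [n _ hn] : nbhs (0 : \bar R)%E (fun z => z < (e / 2)%:E)%E.
    by apply: open_ereal_lt'; rewrite lte_fin.
  by exists n; apply: (hn n) => /=.
pose h := e / 2 / n.+1%:R; have h0 : 0 < h by rewrite divr_gt0.
have /choice[q hq] : forall k, exists q : rat, `|nth_coord x k - ratr q| < h.
  move=> k; have /rat_in_itvoo[q] : nth_coord x k - h < nth_coord x k + h.
    by rewrite ltrBlDr -addrA ltrDl addr_gt0.
  rewrite in_itv/= => /andP[xq qx]; exists q.
  by rewrite ltr_norml; apply/andP; split; lra.
pose s := mkseq q n; exists s.
rewrite -lte_fin norm1E enorm1_nneseries (nneseries_split 0 n)//.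
have nsub k : nth_coord (val (x - rat_point s)) k =
    nth_coord x k - nth_coord (rat_series s) k.
  by rewrite /nth_coord; case: (pickle_inv k) => [v|]; rewrite ?subr0.
have ss : size s = n by rewrite size_mkseq.
have tl : (\sum_(n <= k <oo) `|nth_coord (val (x - rat_point s)) k|%:E <
    (e / 2)%:E)%E.
  move: hn; rewrite [in X in X -> _]eseries_cond.
  rewrite [in X in _ -> X]eseries_cond => hn.
  apply: le_lt_trans hn; rewrite le_eqVlt; apply/orP; left; apply/eqP.
  apply: eq_eseriesr => k /= nk.
  by rewrite nsub nth_coord_rat_series ?ss// subr0.
rewrite (splitr e) EFinD add0n lte_leD//; last exact: ltW.
- by rewrite ge0_fin_numE ?nneseries_ge0// (lt_trans tl)// ltry.
- rewrite sumEFin lte_fin (@le_lt_trans _ _ (\sum_(0 <= k < n) h))//.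
    rewrite big_nat [leRHS]big_nat ler_sum// => k /= kn; rewrite nsub.
    rewrite /nth_coord /rat_series; have := @pickle_invK (word d) k.
    have := hq k; rewrite /nth_coord.
    case: (pickle_inv k) => /= [v xq vk|_ _]; last by rewrite subr0 normr0 ltW.
    by rewrite vk nth_mkseq ?ltW.
  rewrite sumr_const_nat subn0 -[ltLHS]mulr_natr /h -mulrA gtr_pMr//.
  by rewrite ltr_pdivrMl// mulr1 ltr_nat.
Qed.

End borel_l1.

Section measurability_l1.
Context {R : realType} {d : nat}.
Context {disp : measure_display} {T : measurableType disp}.
Local Notation q s := (rat_point s : L1 R d).
Implicit Types (v : word d) (S : T -> tensor_series R d).

Lemma measurable_enorm1 S : (forall v, measurable_fun setT (fun w => S w v)) ->
  measurable_fun setT (fun w => enorm1 (S w)).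
Proof.
move=> mS; rewrite (_ : (fun _ => _) =
    fun w => (\sum_(k <oo | k \in xpredT)
      `|nth_coord (S w) k|%:E)%E); last first.
  by apply/funext => w; rewrite enorm1_nneseries.
apply: ge0_emeasurable_sum => // k _; apply/measurable_EFinP.
apply: measurableT_comp => //; rewrite /nth_coord.
by case: (pickle_inv k) => [v|]; [exact: mS|exact: measurable_cst].
Qed.

Lemma norm1_distC (x y : L1 R d) : norm1 (x - y) = norm1 (y - x).
Proof. by rewrite -opprB -scaleN1r norm1Z normrN1 mul1r. Qed.

Lemma L1_ball (x y : L1 R d) (e : R) : ball x e y <-> norm1 (y - x) < e.
Proof. by rewrite -ball_normE /= distrC. Qed.

(** The space being separable, an open set is a countable union of balls, and
    balls are described by the coordinates. *)
Lemma measurable_L1 (X : T -> L1 R d) :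
  (forall v, measurable_fun setT (fun w => (X w : tensor_series R d) v)) ->
  measurable_fun setT (X : T -> L1_borel R d).
Proof.
move=> mX.
apply: (@measurability _ _ T (L1_borel R d) setT X (@open (L1 R d))) => //.
move=> _ [U oU <-]; rewrite setTI.
(* a countable base: balls around rational points, of radius 1 / n.+1 *)
pose good (sn : seq rat * nat) := `[< ball (q sn.1) (sn.2.+1%:R^-1) `<=` U >].
pose B (sn : seq rat * nat) := [set w | norm1 (X w - q sn.1) < sn.2.+1%:R^-1].
have -> : X @^-1` U = \bigcup_k (if unpickle k is Some sn then
    if good sn then B sn else set0 else set0).
  apply/seteqP; split=> w /=; last first.
    move=> [k _]; case: (unpickle k) => // sn; case: ifP => // /asboolP sU.
    by move=> Bw; apply: sU; apply/L1_ball.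
  move=> UX; have : nbhs (X w : L1 R d) U.
    by apply: (@open_nbhs_nbhs (L1 R d)); split.
  move=> /nbhs_ballP[e /= e0 eU].
  pose n := Num.truncn (2 / e).
  have ne : n.+1%:R^-1 < e / 2.
    rewrite -[e / 2]invrK ltf_pV2 ?posrE// ?invr_gt0 ?divr_gt0//.
    by rewrite invf_div; exact: truncnS_gt.
  have n0 : 0 < n.+1%:R^-1 :> R by [].
  have [s hs] := rat_point_dense (X w) n0.
  exists (pickle (s, n)) => //; rewrite pickleK.
  rewrite ifT//; apply/asboolP => y /= /L1_ball ys; apply: eU; apply/L1_ball.
  rewrite (splitr e); have := ler_norm1D (y - q s) (q s - X w).
  rewrite addrA subrK => /le_lt_trans; apply; apply: ltrD.
    exact: lt_trans ys ne.
  by rewrite norm1_distC; exact: lt_trans hs ne.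
apply: bigcupT_measurable => k; case: (unpickle k) => // sn; case: ifP => // _.
rewrite (_ : B sn = (fun w => enorm1 (val (X w - q sn.1))) @^-1`
    `]-oo, (sn.2.+1%:R^-1)%:E[%classic); last first.
  by apply/seteqP; split=> w; rewrite /B/= in_itv/= -lte_fin norm1E.
rewrite -[_ @^-1` _]setTI.
apply: (measurable_enorm1 (S := fun w => val (X w - q sn.1))) => //.
  by move=> v; apply: measurable_funB => //; exact: mX.
exact: emeasurable_itv.
Qed.

(** A series that is not summable is replaced by 0, coordinate by coordinate;
    summability is itself a measurable condition on the coordinates. *)
Lemma measurable_to_L1 S : (forall v, measurable_fun setT (fun w => S w v)) ->
  measurable_fun setT (fun w => to_L1 (S w)).
Proof.
move=> mS; apply: measurable_L1 => v.
pose E := [set w | S w \in in_L1].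
have mE : measurable E.
  rewrite -[E]setTI; apply: (@emeasurable_fun_infty_o _ T R setT) => //.
  exact: measurable_enorm1.
rewrite (_ : (fun _ => _) = fun w => S w v * \1_E w).
  by apply: measurable_funM; [exact: mS|exact: measurable_indic].
apply/funext => w; rewrite indicE /to_L1 val_insubd.
have -> : (w \in E) = in_L1 (S w) by apply/idP/idP; rewrite inE.
by case: ifP => _; rewrite ?mulr1// mulr0.
Qed.

(** Coordinates are 1-Lipschitz. *)
Lemma measurable_coord v :
  @measurable_fun _ _ (L1_borel R d) R setT (fun x => L1val (x : L1 R d) v).
Proof.
apply: (@measurability _ _ (L1_borel R d) R setT
  (fun x => L1val (x : L1 R d) v) _ (RGenOInfty.measurableE R)).
move=> _ [_ [c ->] <-]; rewrite setTI; apply: sub_sigma_algebra => /=.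
rewrite openE => x /=; rewrite in_itv/= andbT => cx.
apply/nbhs_ballP; exists (L1val (x : L1 R d) v - c).
  by rewrite /= subr_gt0.
move=> y /L1_ball yx; rewrite /= in_itv/= andbT.
have : `|L1val (x : L1 R d) v - L1val (y : L1 R d) v| <= norm1 (y - x).
  rewrite distrC -lee_fin norm1E; apply: esum_ge; exists [set v].
    by split; [exact: finite_set1|].
  by rewrite fsbig_set1.
by rewrite ler_norml => /andP[_] h; lra.
Qed.

End measurability_l1.

(** * Stratonovich integrals as limits of trapezoidal sums *)

Section stratonovich_sums.
Context {disp : measure_display} {T : measurableType disp} {R : realType}.
Variable P : probability T R.
Implicit Types (X Y : R -> T -> R) (a b u v : R) (Z : T -> R) (w : T).

(** The Ito term plus one half of the covariation term over [u, v]. *)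
Definition trapezoid X Y u v w : R := (X u w + X v w) / 2 * (Y v w - Y u w).

Lemma trapezoid_sum X Y a b p w :
  partition_sum (trapezoid X Y) a b p w =
  partition_sum (fun u v w => X u w * (Y v w - Y u w)) a b p w +
  2^-1 * partition_sum (fun u v w => (X v w - X u w) * (Y v w - Y u w)) a b p w.
Proof.
rewrite /partition_sum mulr_sumr -big_split/=; apply: eq_bigr => k _.
by rewrite /trapezoid; field.
Qed.

Lemma partition_sum_scale (c : R) (phi psi : R -> R -> T -> R) a b p w :
  (forall u v, phi u v w = c * psi u v w) ->
  partition_sum phi a b p w = c * partition_sum psi a b p w.
Proof.
by move=> e; rewrite /partition_sum mulr_sumr; apply: eq_bigr => k _.
Qed.

Lemma deviation_scale (c e : R) Z : 0 < c ->
  deviation (c * e) (fun w => c * Z w) = deviation e Z.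
Proof.
move=> c0; apply/seteqP; split=> w; rewrite /deviation/= normrM gtr0_norm//;
  by rewrite ler_pM2l.
Qed.

Lemma measurable_trapezoid K X Y u v : sigma_algebra setT K ->
  measurable_wrt K (X u) -> measurable_wrt K (X v) ->
  measurable_wrt K (fun w => Y v w - Y u w) ->
  measurable_wrt K (trapezoid X Y u v).
Proof.
move=> sK /(measurable_wrtP _ sK) mXu /(measurable_wrtP _ sK) mXv
  /(measurable_wrtP _ sK) mY.
apply/(measurable_wrtP _ sK); apply: measurable_funM => //.
apply: measurable_funM => //; exact: measurable_funD.
Qed.

Section measurable_integrands.
Variables X Y : R -> T -> R.
Hypotheses (mX : forall u, measurable_fun setT (X u))
  (mY : forall u, measurable_fun setT (Y u)).

Lemma measurable_partition_sumT phi a b p : itv_partition a b p ->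
  (forall u v, measurable_fun setT (phi u v : T -> R)) ->
  measurable_fun setT (partition_sum phi a b p).
Proof.
move=> abp mphi; apply/measurable_wrtT; apply: measurable_partition_sum abp _.
  exact: measurable_sigma_algebra.
by move=> u v _ _ _; apply/measurable_wrtT.
Qed.

Lemma measurable_trapezoid_sum a b p : itv_partition a b p ->
  measurable_fun setT (partition_sum (trapezoid X Y) a b p).
Proof.
move=> abp; apply: measurable_partition_sumT abp _ => u v.
apply/measurable_wrtT.
apply: measurable_trapezoid; first exact: measurable_sigma_algebra.
- exact/measurable_wrtT.
- exact/measurable_wrtT.
- by apply/measurable_wrtT; exact: measurable_funB.
Qed.

(** A single family of sums for the Ito integral and the covariation together,
    taken along the same partitions. *)
Lemma stratonovich_sums_cvg a b Z : measurable_fun setT Z ->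
  is_stratonovich_integral P X Y a b Z ->
  partition_sums_cvg P (trapezoid X Y) a b Z.
Proof.
move=> mZ [I [C [hI hC hZ]]] eps eta eps0 eta0.
have eps20 : 0 < eps / 2 by rewrite divr_gt0.
have eta20 : 0 < eta / 2 by rewrite divr_gt0.
have [d1 d10 h1] := hI _ _ eps20 eta20.
have [d2 d20 h2] := hC _ _ eps0 eta20.
exists (Num.min d1 d2); first by rewrite lt_min d10.
move=> p abp; rewrite lt_min => /andP[m1 m2].
rewrite (splitr eps) (splitr eta).
pose ito u v w := X u w * (Y v w - Y u w).
pose cov u v w := (X v w - X u w) * (Y v w - Y u w).
have mI := measurable_partition_sumT abp (phi := ito).
have mC := measurable_partition_sumT abp (phi := cov).
apply: (@deviation_add _ _ _ P _ (fun w => partition_sum ito a b p w - I w)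
   (fun w => 2^-1 * (partition_sum cov a b p w - C w))).
- by apply: measurable_funB => //; exact: measurable_trapezoid_sum.
- apply: measurable_funB => //; apply: mI => u v.
  by apply: measurable_funM => //; exact: measurable_funB.
- apply: measurable_funM => //; apply: measurable_funB => //; apply: mC => u v.
  by apply: measurable_funM; exact: measurable_funB.
- apply: filterS hZ => w ->; rewrite trapezoid_sum -/ito -/cov.
  apply: le_trans (ler_normD _ _).
  by rewrite le_eqVlt; apply/orP; left; apply/eqP; congr (`|_|); ring.
- exact: h1.
- rewrite [eps / 2]mulrC deviation_scale ?invr_gt0//; exact: h2.
Qed.

(** Choose the lower end a first, to be close to the improper integral, and then
    the partition of [a, b]. *)
Lemma improper_stratonovich_sums b Z : measurable_fun setT Z ->
  is_improper_stratonovich_integral P X Y b Z ->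
  forall eps eta : R, 0 < eps -> 0 < eta ->
  exists2 A, A <= b & forall a, a < A ->
  exists2 delta : R, 0 < delta & forall p, itv_partition a b p ->
    mesh a b p < delta ->
    (P (deviation eps (fun w => partition_sum (trapezoid X Y) a b p w - Z w)%R)
      < eta%:E)%E.
Proof.
move=> mZ [J [hJ cvJ]] eps eta eps0 eta0.
have eps20 : 0 < eps / 2 by rewrite divr_gt0.
have eta20 : 0 < eta / 2 by rewrite divr_gt0.
have /(cvJ _ eps20) [A [_ hA]] :
    nbhs (0 : \bar R)%E (fun z => z < (eta / 2)%:E)%E.
  by apply: open_ereal_lt'; rewrite lte_fin.
exists (Num.min A b); first by rewrite ge_min lexx orbT.
move=> a; rewrite lt_min => /andP[aA ab].
have [delta d0 hd] :=
  stratonovich_sums_cvg (measurable_funPT (J a)) (hJ a ab) eps20 eta20.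
exists delta => // p abp mp; rewrite (splitr eps) (splitr eta).
apply: (@deviation_add _ _ _ P _
   (fun w => partition_sum (trapezoid X Y) a b p w - J a w)
   (fun w => J a w - Z w)).
- by apply: measurable_funB => //; exact: measurable_trapezoid_sum.
- by apply: measurable_funB => //; exact: measurable_trapezoid_sum.
- exact: measurable_funB.
- apply: aeW => w; apply: le_trans (ler_normD _ _).
  by rewrite addrA subrK.
- exact: hd.
- exact: hA.
Qed.

End measurable_integrands.
End stratonovich_sums.

(** * The information carried by the signature *)

Section efm_measurability.
Context {disp : measure_display} {T : measurableType disp} {R : realType}.
Variables (P : probability T R) (d : nat) (lambda : 'I_d.+1 -> R).
Variables (W : R -> 'I_d -> {RV P >-> R}) (Sg : R -> word d -> {RV P >-> R}).
Hypothesis SgW : is_efm_signature lambda W Sg.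
Implicit Types (K : set (set T)) (v : word d) (i : 'I_d.+1) (s t u r : R).

Definition efm_integrand t v i u w : R :=
  expR (- word_rate lambda (rcons v i) * (t - u)) * Sg u v w.

Definition efm_trapezoid t v i : R -> R -> T -> R :=
  trapezoid (efm_integrand t v i) (time_extension W i).

Lemma measurable_efm_integrand t v i u :
  measurable_fun setT (efm_integrand t v i u).
Proof. exact: measurable_funM. Qed.

Lemma measurable_time_extension i u :
  measurable_fun setT (time_extension W i u).
Proof. by rewrite /time_extension; case: unlift. Qed.

Lemma measurable_efm_trapezoid K t v i u r : sigma_algebra setT K ->
  measurable_wrt K (Sg u v) -> measurable_wrt K (Sg r v) ->
  measurable_wrt K (fun w => time_extension W i r w - time_extension W i u w) ->
  measurable_wrt K (efm_trapezoid t v i u r).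
Proof.
move=> sK mu mr mW; apply: measurable_trapezoid => //;
  by apply: measurable_wrtM => //; exact: measurable_wrt_cst.
Qed.

Lemma measurable_efm_nil K t :
  null_complete P K -> measurable_wrt K (Sg t [::]).
Proof.
move=> cK; apply: (measurable_wrt_ae cK _ (SgW.1 t)) => //.
exact: measurable_wrt_cst (null_complete_sigma cK) 1.
Qed.

(** By induction on the word, each trapezoidal sum at time t involves only
    shorter words at earlier times and increments up to t. *)
Lemma measurable_efm_past (K : R -> set (set T)) :
  (forall t, null_complete P (K t)) -> (forall s t, s <= t -> K s `<=` K t) ->
  (forall i s u t, s <= u -> u <= t ->
    measurable_wrt (K t)
      (fun w => time_extension W i u w - time_extension W i s w)) ->
  forall v t, measurable_wrt (K t) (Sg t v).
Proof.
move=> cK K_incr mW; elim/last_ind => [t|v i IHv t].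
  exact: measurable_efm_nil.
have sK := null_complete_sigma (cK t).
apply: (measurable_wrt_limit_prob (cK t)) => // eps eta eps0 eta0.
have [A At hA] := improper_stratonovich_sums (measurable_efm_integrand t v i)
  (measurable_time_extension i) (measurable_funPT (Sg t (rcons v i)))
  (SgW.2 t v i) eps0 eta0.
have a_lt : A - 1 < A by rewrite ltrBlDr ltrDl.
have [delta d0 hd] := hA _ a_lt.
have [p atp dp] := fine_partition (lt_le_trans a_lt At) d0.
exists (partition_sum (efm_trapezoid t v i) (A - 1) t p).
  apply: measurable_partition_sum atp _ => // u r _ ur rt.
  apply: measurable_efm_trapezoid => //; last exact: mW.
    by apply: measurable_wrt_sub (IHv u); apply: K_incr; exact: le_trans rt.
  by apply: measurable_wrt_sub (IHv r); exact: K_incr.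
by apply: hd => //; exact: mesh_lt.
Qed.

(** Extend a partition p of [s, t] by a partition q of [a, s]. The sum over
    q ++ p is close to the component at time t. Its part over q is close to the
    discounted component at time s, as the exponential kernel at time t is a
    constant times the one at time s. The part over p is the difference. *)
Lemma efm_increment_sums s t v i (eps eta : R) : s < t -> 0 < eps -> 0 < eta ->
  exists2 p, itv_partition s t p &
  (P (deviation eps (fun w =>
     partition_sum (efm_trapezoid t v i) s t p w -
     (Sg t (rcons v i) w -
      expR (- word_rate lambda (rcons v i) * (t - s)) * Sg s (rcons v i) w))%R)
   < eta%:E)%E.
Proof.
move=> st eps0 eta0; set c := expR _; have c0 : 0 < c by exact: expR_gt0.
have eps20 : 0 < eps / 2 by rewrite divr_gt0.
have eta20 : 0 < eta / 2 by rewrite divr_gt0.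
have mE := @measurable_efm_integrand; have mW := measurable_time_extension.
have [At Att hAt] := improper_stratonovich_sums (mE t v i)
  (mW i) (measurable_funPT (Sg t (rcons v i)))
  (SgW.2 t v i) eps20 eta20.
have [As Ass hAs] := improper_stratonovich_sums (mE s v i)
  (mW i) (measurable_funPT (Sg s (rcons v i)))
  (SgW.2 s v i) (divr_gt0 eps20 c0) eta20.
pose a := Num.min At As - 1.
have a_lt : a < Num.min At As by rewrite ltrBlDr ltrDl.
have [aAt aAs] : a < At /\ a < As by move: a_lt; rewrite lt_min => /andP[].
have [dt dt0 hdt] := hAt _ aAt; have [ds ds0 hds] := hAs _ aAs.
have d0 : 0 < Num.min dt ds by rewrite lt_min dt0.
have [p stp dp] := fine_partition st d0.
have [q asq dq] := fine_partition (lt_le_trans aAs Ass) d0.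
have wider l b dl : path (fun x y : R => y - x < Num.min dt ds) b l ->
    Num.min dt ds <= dl -> path (fun x y => y - x < dl) b l.
  by move=> + le; apply: sub_path => x y /= xy; exact: lt_le_trans le.
have atqp : itv_partition a t (q ++ p) := itv_partition_cat asq stp.
have lq : last a q = s by case: asq => _ /eqP.
exists p => //; rewrite (splitr eps) (splitr eta).
apply: (@deviation_add _ _ _ P _
   (fun w => partition_sum (efm_trapezoid t v i)
       a t (q ++ p) w - Sg t (rcons v i) w)
   (fun w => c * (partition_sum (efm_trapezoid s v i)
       a s q w - Sg s (rcons v i) w))).
- apply: measurable_funB; first exact: measurable_trapezoid_sum.
  by apply: measurable_funB => //; exact: measurable_funM.
- by apply: measurable_funB => //; exact: measurable_trapezoid_sum.
- apply: measurable_funM => //; apply: measurable_funB => //.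
  exact: measurable_trapezoid_sum.
- apply: aeW => w; apply: le_trans (ler_normB _ _).
  rewrite le_eqVlt; apply/orP; left; apply/eqP; congr (`|_|).
  rewrite (partition_sum_cat _ _ s) lq.
  rewrite (@partition_sum_scale _ _ _ c _ (efm_trapezoid s v i) a s q).
    by ring.
  move=> u r; rewrite /efm_trapezoid /trapezoid /efm_integrand.
  have cE x : expR (- word_rate lambda (rcons v i) * (t - x)) =
      c * expR (- word_rate lambda (rcons v i) * (s - x)).
    by rewrite /c -expRD; congr expR; ring.
  by rewrite !cE; field.
- apply: hdt => //; apply: mesh_lt => //; rewrite cat_path lq.
  by rewrite !(wider _ _ dt)// ge_min lexx.
- rewrite -[eps / 2](mulfVK (lt0r_neq0 c0)) mulrC deviation_scale//.
  apply: hds => //; apply: mesh_lt => //.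
  by rewrite (wider _ _ ds)// ge_min lexx orbT.
Qed.

(** By induction on the word: the component at time t is the discounted
    component at time s plus a limit of sums over [s, t], which involve only a
    shorter word and increments after s. *)
Lemma measurable_efm_future K s : null_complete P K ->
  (forall v, measurable_wrt K (Sg s v)) ->
  (forall i u t, s <= u -> u <= t ->
    measurable_wrt K
      (fun w => time_extension W i t w - time_extension W i u w)) ->
  forall v t, s <= t -> measurable_wrt K (Sg t v).
Proof.
move=> cK mS mW; elim/last_ind => [t _|v i IHv t].
  exact: measurable_efm_nil.
rewrite le_eqVlt => /predU1P[<-|st]; first exact: mS.
have sK := null_complete_sigma cK.
pose c := expR (- word_rate lambda (rcons v i) * (t - s)).
have mcS : measurable_wrt K (fun w => c * Sg s (rcons v i) w).
  by apply: measurable_wrtM => //; exact: measurable_wrt_cst.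
have mI : measurable_wrt K
    (fun w => Sg t (rcons v i) w - c * Sg s (rcons v i) w).
  apply: (measurable_wrt_limit_prob cK).
    by apply: measurable_funB => //; exact: measurable_funM.
  move=> eps eta eps0 eta0.
  have [p stp hp] := efm_increment_sums v i st eps0 eta0.
  exists (partition_sum (efm_trapezoid t v i) s t p) => //.
  apply: measurable_partition_sum stp _ => // u r su ur rt.
  apply: measurable_efm_trapezoid => //; last exact: mW.
    exact: IHv.
  by apply: IHv; exact: le_trans ur.
have -> : (Sg t (rcons v i) : T -> R) = fun w =>
    (Sg t (rcons v i) w - c * Sg s (rcons v i) w) + c * Sg s (rcons v i) w.
  by apply/funext => w; rewrite subrK.
exact: measurable_wrtD.
Qed.

End efm_measurability.

(** * The Markov property *)

Theorem theorem5p2 (R : realType) (disp : measure_display)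
    (T : measurableType disp) (P : probability T R) (d : nat)
    (lambda : 'I_d.+1 -> R) (F : R -> set (set T))
    (W : R -> 'I_d -> {RV P >-> R}) (Sg : R -> word d -> {RV P >-> R})
    (lambda_gt0 : forall i, 0 < lambda i)
    (filtF : filtration F)
    (WBM : two_sided_brownian_motion F W)
    (SgW : is_efm_signature lambda W Sg)
    (SgL1 : forall t, {ae P, forall w, series_at Sg t w \in in_L1})
    (f : L1_borel R d -> R) (mf : measurable_fun setT f)
    (bf : exists M : R, forall x, `|f x| <= M)
    (s t : R) (st : s <= t) :
  let What u w := to_L1 (series_at Sg u w) in
  {ae P, forall w,
    cond_exp P (F s) (f \o What t) w =
    cond_exp P (g_sigma_algebra_preimage (What s)) (f \o What t) w}.
Proof.
move=> What; case: bf => M bf.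
have sF := filtration_sigma filtF; have Fm := filtration_measurable filtF.
pose FF u := null_augment P (F u).
have cFF u : null_complete P (FF u) := null_augment_complete P (sF u) (@Fm u).
have mWhatK K u : sigma_algebra setT K ->
    (forall v, measurable_wrt K (Sg u v)) ->
    measurable_fun setT (What u : g_sigma_algebraType K -> L1_borel R d).
  move=> sK mS; apply: measurable_to_L1 => v.
  exact/(measurable_wrtP _ sK)/mS.
have mWhat u : measurable_fun setT (What u).
  by apply: measurable_to_L1 => v.
pose G := g_sigma_algebra_preimage (What s).
have sG : sigma_algebra setT G.
  exact: (@measurable_sigma_algebra _ (g_sigma_algebra_preimageType (What s))).
have Gm : G `<=` measurable by move=> _ [B mB <-]; exact: mWhat.
pose GG := null_augment P G.
have cGG : null_complete P GG := null_augment_complete P sG Gm.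
have mW i u r q : u <= r -> r <= q -> measurable_wrt (FF q)
    (fun w => time_extension W i r w - time_extension W i u w).
  move=> ur rq; rewrite /time_extension; case: unlift => [j|].
    apply: measurable_wrt_sub (tsbm_increment_adapted WBM j ur rq).
    exact: sub_null_augment.
  exact: measurable_wrt_cst (null_complete_sigma (cFF q)) _.
have FF_incr u r : u <= r -> FF u `<=` FF r.
  move=> ur; apply: null_augment_min => // A /(filtration_incr filtF ur).
  exact: sub_null_augment.
have mSF := measurable_efm_past SgW cFF FF_incr mW.
have GF : GG `<=` FF s.
  apply: null_augment_min => // A [B mB <-].
  have := mWhatK _ s (null_complete_sigma (cFF s)) (fun v => mSF v s).
  move=> /(_ measurableT B mB).
  by rewrite sub_sigma_algebraE//; exact: null_complete_sigma.
pose H := future_increments W s.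
have sH : sigma_algebra setT H by exact: smallest_sigma_algebra.
have Hm : H `<=` measurable by exact: future_increments_measurable.
have HF : independent2 P H (FF s).
  apply: independent_null_augment => //.
  exact: independent_future_increments.
pose J := <<s GG `|` H>>; pose K := null_augment P J.
have Jm : J `<=` measurable.
  by apply: g_sigma_algebra_measurable => A [/(null_complete_sub cGG)|/Hm].
have sJ : sigma_algebra setT J by exact: smallest_sigma_algebra.
have cK : null_complete P K := null_augment_complete P sJ Jm.
have sK := null_complete_sigma cK.
have GGK : GG `<=` K.
  by move=> A GA; apply: sub_null_augment => //; apply: sub_sigma_algebra; left.
have HK : H `<=` K.
  move=> A HA; apply: sub_null_augment => //.
  by apply: sub_sigma_algebra; right.
(* a summable series has the coordinates of the point of L1 that it defines *)
have mSs v : measurable_wrt K (Sg s v).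
  apply: measurable_wrt_sub GGK _.
  apply: (@measurable_wrt_ae _ _ _ P _ _
    (fun w => L1val (What s w : L1 R d) v) cGG) => //.
    apply: filterS (SgL1 s) => w Lw.
    by rewrite /What /to_L1 val_insubd ifT.
  apply: measurable_wrt_sub (sub_null_augment _ Gm) _ => B mB.
  exists ((fun x : L1_borel R d => L1val (x : L1 R d) v) @^-1` B).
    by rewrite -[_ @^-1` _]setTI; exact: measurable_coord.
  by rewrite setTI.
have mWs i u r : s <= u -> u <= r ->
    measurable_wrt K (fun w => time_extension W i r w - time_extension W i u w).
  move=> su ur; rewrite /time_extension; case: unlift => [j|]; last first.
    exact: measurable_wrt_cst.
  have mj x : s <= x -> measurable_wrt K (fun w => W x j w - W s j w).
    rewrite le_eqVlt => /predU1P[<-|sx].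
      rewrite (_ : (fun _ => _) = cst 0); first exact: measurable_wrt_cst.
      by apply/funext => w; rewrite subrr.
    apply: measurable_wrt_sub HK _.
    exact: (@measurable_sigma_gen _ _ _ _
      (fun ui : {u | s < u} * 'I_d => increment W s (sval ui.1, ui.2))
      (exist _ x sx, j)).
  rewrite (_ : (fun _ => _) =
      fun w => (W r j w - W s j w) - (W u j w - W s j w)).
    by apply: measurable_wrtB => //; apply: mj => //; exact: le_trans ur.
  by apply/funext => w; ring.
have mSt v : measurable_wrt K (Sg t v).
  exact: (measurable_efm_future SgW cK mSs mWs).
have mX : measurable_wrt K (f \o What t).
  apply/(measurable_wrtP _ sK); apply: measurableT_comp => //; exact: mWhatK.
have bX w : `|(f \o What t) w| <= M by exact: bf.
have mXT : measurable_fun setT (f \o What t).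
  exact: measurable_wrt_fun (null_complete_sub cK) mX.
have iX : P.-integrable setT (EFin \o (f \o What t)).
  exact: integrable_bounded bX.
have [Z cZ bZ] := bounded_cond_exp P (null_complete_sigma cGG)
  (null_complete_sub cGG) mXT bX.
have cZF : is_cond_exp P (FF s) (f \o What t) Z.
  exact: is_cond_exp_independent_join cGG (cFF s) GF sH Hm HF mX bX cZ bZ.
(* completing a sigma-algebra by null sets keeps conditional expectations *)
have FX := is_cond_exp_null_augment (@Fm s) iX
  (is_cond_exp_cond_exp (sF s) (@Fm s) iX).
have GX := is_cond_exp_null_augment Gm iX (is_cond_exp_cond_exp sG Gm iX).
have FZ := cond_exp_unique (null_complete_sigma (cFF s))
  (null_complete_sub (cFF s)) iX FX cZF.
have GZ := cond_exp_unique (null_complete_sigma cGG)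
  (null_complete_sub cGG) iX GX cZ.
by apply: filterS2 FZ GZ => w /= -> ->.
Qed.
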